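(* There exist real analytic maps $T:\mathbb{T}^3\to\mathbb{T}^3$ that preserve the Haar measure $\mu$ on $\mathbb{T}^3=\mathbb{R}^3/\mathbb{Z}^3$, are mixing of all orders, and do not have the Monotone Shrinking Target Property (with respect to $\mu$).
   Context: Mixing of all orders: a system $(T,M,\mu)$ is mixing of order $p\ge2$ if for any sequence $(u_n^{(1)},\dots,u_n^{(p-1)})_{n\in\mathbb{N}}$, where for each $i$ the $u_n^{(i)}$ are integers with $\lim_{n\to\infty}u_n^{(i)}=\infty$, and for any measurable sets $A_0,\dots,A_{p-1}\subset M$, $$\lim_{n\to\infty}\mu\left(T^{-u_n^{(1)}-\cdots-u_n^{(p-1)}}A_{p-1}\cap\cdots\cap T^{-u_n^{(1)}}A_1\cap A_0\right)=\mu(A_{p-1})\cdots\mu(A_0).$$ It is mixing of all orders if it is mixing of order $p$ for every $p\ge2$. Monotone Shrinking Target Property (MSTP) of a probability measure preserving system $(T,M,\mu)$ on a metric space $M$: for every $x_0\in M$ and every sequence of radii with $0\le r_{n+1}\le r_n$ for all $n\in\mathbb{N}$ and $\sum_{n=0}^\infty\mu(B(x_0,r_n))=\infty$, one has $\mu\left(\bigcap_{n_0\in\mathbb{N}}\bigcup_{n\ge n_0}T^{-n}B(x_0,r_n)\right)=1$. Here $B(x_0,r)$ is the open ball of center $x_0$ and radius $r$; on $\mathbb{T}^3$ the distance is the one induced by the sup norm on $\mathbb{R}^3$. *)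

(* Defs.v *)
From HB Require Import structures.
From mathcomp Require Import all_boot all_order all_algebra generic_quotient.
From mathcomp Require Import all_classical all_reals all_analysis.

Set Implicit Arguments.
Unset Strict Implicit.
Unset Printing Implicit Defensive.

Import Order.TTheory GRing.Theory Num.Theory.
Import numFieldNormedType.Exports.

Local Open Scope classical_set_scope.
Local Open Scope ring_scope.

Section dynamics.
Context d (M : measurableType d) (R : realType).
Implicit Types (mu : set M -> \bar R) (T : M -> M).

Definition measure_preserving mu T :=
  measurable_fun setT T /\
  forall A, measurable A -> mu (T @^-1` A) = mu A.

(* [T] need not be invertible, so the times are natural numbers.  The time
   attached to [A j] is the sum of the first [j] sequences. *)
Definition mixing_of_order (p : nat) mu T :=
  forall u : 'I_p.-1 -> nat -> nat,
    (forall i, u i n @[n --> \oo] --> \oo) ->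
  forall A : 'I_p -> set M, (forall j, measurable (A j)) ->
    mu (\bigcap_(j in [set: 'I_p]) iter (\sum_(i < p.-1 | (i < j)%N) u i n) T @^-1` A j)
      @[n --> \oo] --> (\prod_(j < p) mu (A j))%E.

Definition mixing_of_all_orders mu T :=
  forall p, (2 <= p)%N -> mixing_of_order p mu T.

End dynamics.

Definition MSTP (R : realType) (M : metricType R) (mu : set M -> \bar R)
    (T : M -> M) :=
  forall (x0 : M) (r : nat -> R),
    (forall n, 0 <= r n.+1 <= r n) ->
    (\sum_(0 <= n <oo) mu (ball x0 (r n)) = +oo)%E ->
    mu (\bigcap_n0 \bigcup_(n in [set n | (n0 <= n)%N])
          iter n T @^-1` ball x0 (r n)) = 1%E.

Section torus.
Variable R : realType.

Definition int_vector (v : R * R * R) : bool :=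
  [&& v.1.1 \is a Num.int, v.1.2 \is a Num.int & v.2 \is a Num.int].

Definition torus_eqv (x y : R * R * R) := int_vector (x - y).

Lemma int_vectorD v w : int_vector v -> int_vector w -> int_vector (v + w).
Proof. by move=> /and3P[? ? ?] /and3P[? ? ?]; apply/and3P; split; rewrite rpredD. Qed.

Lemma int_vectorN v : int_vector (- v) = int_vector v.
Proof. by rewrite /int_vector !rpredN. Qed.

Lemma torus_eqv_refl : reflexive torus_eqv.
Proof. by move=> x; rewrite /torus_eqv subrr /int_vector !rpred0. Qed.

Lemma torus_eqv_sym : symmetric torus_eqv.
Proof. by move=> x y; rewrite /torus_eqv -opprB int_vectorN. Qed.

Lemma torus_eqv_trans : transitive torus_eqv.
Proof.
move=> y x z xy yz.
by rewrite /torus_eqv -[x - z](subrKA y); exact: int_vectorD.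
Qed.

Canonical torus_eqv_equiv :=
  EquivRel torus_eqv torus_eqv_refl torus_eqv_sym torus_eqv_trans.

Definition torus : Type := {eq_quot torus_eqv}%qT.
HB.instance Definition _ := Choice.on torus.

Definition torus_pi (x : R * R * R) : torus := \pi_({eq_quot torus_eqv})%qT x.

Lemma torus_pi_eq x y : torus_pi x = torus_pi y <-> int_vector (x - y).
Proof. by split => [/eqmodP//|xy]; apply/eqmodP. Qed.

Lemma torus_pi_surj p : exists x, torus_pi x = p.
Proof. by exists (repr (p : {eq_quot torus_eqv}%qT)); exact: reprK. Qed.

(* [`| _ |] on [R * R * R] is the sup norm. *)
Definition torus_dist_set (p q : torus) : set R :=
  [set `|x - y| | x in torus_pi @^-1` [set p] & y in torus_pi @^-1` [set q]].

Definition torus_dist (p q : torus) : R := inf (torus_dist_set p q).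

Lemma torus_dist_set_inf p q : has_inf (torus_dist_set p q).
Proof.
split; last by exists 0 => _ [x _ [y _ <-]].
have [x xp] := torus_pi_surj p; have [y yq] := torus_pi_surj q.
by exists `|x - y|, x => //; exists y.
Qed.

Lemma torus_dist_le x y : torus_dist (torus_pi x) (torus_pi y) <= `|x - y|.
Proof.
apply: ge_inf; first exact: (torus_dist_set_inf _ _).2.
by exists x => //; exists y.
Qed.

Lemma torus_distxx p : torus_dist p p = 0.
Proof.
have [x <-] := torus_pi_surj p.
apply/eqP; rewrite eq_le; apply/andP; split.
  by have := torus_dist_le x x; rewrite subrr normr0.
by apply: lb_le_inf; [exact: (torus_dist_set_inf _ _).1|move=> _ [? _ [? _ <-]]].
Qed.

Lemma torus_dist_sym p q : torus_dist p q = torus_dist q p.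
Proof.
by congr inf; apply/seteqP; split => _ [x xp [y yq <-]];
  exists y => //; exists x => //; rewrite distrC.
Qed.

Lemma torus_dist_triangle q p s :
  torus_dist p s <= torus_dist p q + torus_dist q s.
Proof.
apply/ler_addgt0Pl => e e0; have e20 : 0 < e / 2 by rewrite divr_gt0.
have [_ [x xp [y yq <-]] xy] := inf_adherent e20 (torus_dist_set_inf p q).
have [_ [y' yq' [z zs <-]] yz] := inf_adherent e20 (torus_dist_set_inf q s).
have xp' : torus_pi (x + (y' - y)) = p.
  rewrite -xp; apply/torus_pi_eq; rewrite addrC addKr.
  by apply/torus_pi_eq; rewrite yq yq'.
have := torus_dist_le (x + (y' - y)) z; rewrite xp' zs => /le_trans; apply.
have -> : x + (y' - y) - z = (x - y) + (y' - z).
  by rewrite (addrA x) (addrAC x) [RHS]addrA.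
rewrite (le_trans (ler_normD _ _))// [e in leRHS]splitr.
by rewrite addrACA lerD// addrC ltW.
Qed.

Lemma dist_int_gt0 (c : R) : c \isn't a Num.int ->
  exists2 e : R, 0 < e & forall k, k \is a Num.int -> e <= `|c + k|.
Proof.
move=> cZ; have c_lt : (Num.floor c)%:~R < c.
  rewrite lt_neqAle floor_le andbT; apply: contra cZ => /eqP <-.
  exact: intr_int.
exists (Num.min (c - (Num.floor c)%:~R) ((Num.floor c + 1)%:~R - c)).
  by rewrite lt_min !subr_gt0 c_lt floorD1_gt.
move=> k /intrP[m ->]; have [cm|cm] := leP (- m) (Num.floor c).
  rewrite ge_min; apply/orP; left.
  rewrite (le_trans _ (ler_norm _))// lerD2l -[m]opprK mulrNz lerN2.
  by rewrite ler_int.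
rewrite ge_min; apply/orP; right.
rewrite -normrN (le_trans _ (ler_norm _))// opprD addrC lerD2l.
by rewrite -mulrNz ler_int lezD1.
Qed.

Lemma torus_dist_positivity p q : torus_dist p q = 0 -> p = q.
Proof.
have [x0 <-] := torus_pi_surj p; have [y0 <-] := torus_pi_surj q => pq0.
apply/torus_pi_eq; apply: contrapT => /negP xyZ.
have far (g : R * R * R -> R) : (forall v w, g (v + w) = g v + g w) ->
    (forall v, `|g v| <= `|v|) -> (forall v, int_vector v -> g v \is a Num.int) ->
    g (x0 - y0) \is a Num.int.
  move=> gD g_le gZ; apply: contrapT => /negP /dist_int_gt0[e e0 he].
  suff : e <= torus_dist (torus_pi x0) (torus_pi y0) by rewrite pq0 leNgt e0.
  apply: lb_le_inf; first exact: (torus_dist_set_inf _ _).1.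
  move=> _ [x /torus_pi_eq xx0 [y /torus_pi_eq yy0 <-]].
  have -> : x - y = (x0 - y0) + ((x - x0) - (y - y0)).
    by rewrite opprB addrACA addKr [x0 + _]addrC subrK.
  rewrite (le_trans _ (g_le _))// gD he// gZ// int_vectorD//.
  by rewrite int_vectorN.
move/negP: xyZ; apply; apply/and3P; split.
- apply: (far (fun v => v.1.1)) => // [v|v /and3P[]//].
  by rewrite !prod_normE !le_max lexx.
- apply: (far (fun v => v.1.2)) => // [v|v /and3P[]//].
  by rewrite !prod_normE !le_max lexx !orbT.
- apply: (far (fun v => v.2)) => // [v|v /and3P[]//].
  by rewrite !prod_normE !le_max lexx !orbT.
Qed.

HB.instance Definition _ := @isMetric.Build R torus torus_dist torus_distxx
  torus_dist_positivity torus_dist_sym torus_dist_triangle.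

Local Notation mR := (measurableTypeR R).

(* The quotient of the product Borel sigma-algebra.  Since [torus_pi] is open,
   continuous, and injective on the Borel set [unit_cube], this is also the
   Borel sigma-algebra of the metric [torus_dist]. *)
Definition torus_measurable : set (set torus) :=
  [set A | measurable (torus_pi @^-1` A : set (mR * mR * mR))].

Lemma torus_measurable0 : torus_measurable set0.
Proof. by rewrite /torus_measurable/= preimage_set0. Qed.

Lemma torus_measurableC A : torus_measurable A -> torus_measurable (~` A).
Proof.
by rewrite /torus_measurable/= preimage_setC; exact: measurableC.
Qed.

Lemma torus_measurable_bigcup (F : (set torus)^nat) :
  (forall i, torus_measurable (F i)) -> torus_measurable (\bigcup_i F i).
Proof.
move=> mF; rewrite /torus_measurable/= preimage_bigcup.
exact: bigcupT_measurable.
Qed.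

HB.instance Definition _ := isPointed.Build torus (torus_pi 0).

HB.instance Definition _ := @isMeasurable.Build default_measure_display torus
  torus_measurable torus_measurable0 torus_measurableC torus_measurable_bigcup.

Definition unit_cube : set (mR * mR * mR) :=
  (`[0, 1[ : set mR) `*` (`[0, 1[ : set mR) `*` (`[0, 1[ : set mR).

Lemma measurable_unit_cube : measurable unit_cube.
Proof. by apply: measurableX; [apply: measurableX|]; exact: measurable_itv. Qed.

Definition lebesgue3 : set (mR * mR * mR) -> \bar R :=
  (lebesgue_measure \x lebesgue_measure \x lebesgue_measure)%E.
HB.instance Definition _ := Measure.on lebesgue3.

Lemma lebesgue3_unit_cube : lebesgue3 unit_cube = 1%E.
Proof.
have I1 : lebesgue_measure (`[0, 1[ : set mR) = 1%E.
  by rewrite lebesgue_measure_itv/= lte01 oppr0 adde0.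
have mI : measurable (`[0, 1[ : set mR) by exact: measurable_itv.
rewrite /lebesgue3 /unit_cube product_measure1E//=; last exact: measurableX.
by rewrite product_measure1E//= !I1 !mule1.
Qed.

(* The normalized Haar measure: image under [torus_pi] of the restriction of
   Lebesgue measure to a fundamental domain. *)
Definition haar : set torus -> \bar R :=
  pushforward (mrestr lebesgue3 measurable_unit_cube)
    (torus_pi : mR * mR * mR -> torus).

Lemma haar0 : haar set0 = 0%E.
Proof. by rewrite /haar /pushforward preimage_set0 /mrestr set0I measure0. Qed.

Lemma haar_ge0 A : (0 <= haar A)%E.
Proof. exact: (measure_ge0 lebesgue3). Qed.

Lemma haar_sigma_additive : semi_sigma_additive haar.
Proof.
move=> F mF tF mUF; rewrite /haar /pushforward preimage_bigcup.
apply: (@measure_semi_sigma_additive _ _ _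
  (mrestr lebesgue3 measurable_unit_cube)) => //.
  apply/trivIsetP => /= i j _ _ ij; rewrite -preimage_setI.
  by move/trivIsetP : tF => /(_ _ _ _ _ ij) ->//; rewrite preimage_set0.
Qed.

HB.instance Definition _ := isMeasure.Build _ _ _ haar
  haar0 haar_ge0 haar_sigma_additive.

Lemma haar_setT : haar setT = 1%E.
Proof.
by rewrite /haar /pushforward preimage_setT /mrestr setTI lebesgue3_unit_cube.
Qed.

HB.instance Definition _ := Measure_isProbability.Build _ _ _ haar haar_setT.

Definition monomial (a : nat * nat * nat) (h : R * R * R) : R :=
  h.1.1 ^+ a.1.1 * h.1.2 ^+ a.1.2 * h.2 ^+ a.2.

Definition power_series_psum (n : nat) (c : nat * nat * nat -> R)
    (h : R * R * R) : R :=
  \sum_(i < n) \sum_(j < n) \sum_(k < n)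
    c (i : nat, j : nat, k : nat) * monomial (i : nat, j : nat, k : nat) h.

Definition analytic_at (f : R * R * R -> R) (x : R * R * R) :=
  exists (c : nat * nat * nat -> R) (e : R), 0 < e /\
    forall h : R * R * R, `|h| < e ->
      summable setT (fun a => (c a * monomial a h)%:E) /\
      power_series_psum n c h @[n --> \oo] --> f (x + h).

(* Analyticity in the charts of the torus, which are the local inverses of
   [torus_pi]: near every point, [T] lifts to an analytic map. *)
Definition torus_analytic (T : torus -> torus) :=
  forall x : R * R * R, exists F : R * R * R -> R * R * R,
    [/\ analytic_at (fun y => (F y).1.1) x,
        analytic_at (fun y => (F y).1.2) x,
        analytic_at (fun y => (F y).2) x &
        \forall y \near x, T (torus_pi y) = torus_pi (F y)].

End torus.

(* Main.v *)
From HB Require Import structures.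
Require Import Defs.
From mathcomp Require Import all_boot all_order all_algebra generic_quotient.
From mathcomp Require Import all_classical all_reals all_analysis.
From mathcomp Require Import measurable_realfun.
From mathcomp Require Import ring lra zify.

Set Implicit Arguments.
Unset Strict Implicit.
Unset Printing Implicit Defensive.

Import Order.TTheory GRing.Theory Num.Theory.
Import numFieldNormedType.Exports.

Local Open Scope classical_set_scope.
Local Open Scope ring_scope.

(** The example is a skew product over angle doubling,

      T (x, y, z) = (2 x, y + phi x, z + alpha phi x)   mod Z^3,

    where phi x = cos (2 pi x) and alpha is a Liouville number.  The fibre
    coordinates (y, z) only ever move along the line of direction (1, alpha),
    by at most 1 at each step.

    Shrinking targets.  In n steps, (y, z) stays on a segment of length O(n)
    of that line.  If alpha is extremely close to p / q, then for a very long
    time this segment stays near a closed geodesic of length O(q), so that a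
    ball of radius rho can only be met from a set of measure O(q rho)
    ([hits_resonance], [lebesgue3_resonance]).  With rho = q^-2 up to the time
    q^7, the measures of the targets add up to at least q^7 rho^3 = q
    ([stage_ball_sum]), whereas the points that meet one of them fill a set of
    measure O(1 / q).  Letting q run through the denominators q_k of the good
    approximations of alpha, the targets have infinite total measure, but they
    are all missed by a set of positive measure.

    Mixing.  The transfer operator P averages a function over the two inverse
    branches of T, and the integral of f over the inverse image of B under T^n
    is the integral of P^n f over B ([iter_transfer_duality]).  If P^n f tends
    uniformly to a constant, this integral tends to (int f) mu(B), uniformly in
    B ([lipschitz_exact]).  Dynkin's theorem carries the uniform statement from
    Lipschitz functions to indicators of measurable sets ([measurable_exact]),
    and uniformity in B allows one to peel off the sets of a multiple
    correlation one at a time ([multiple_mixing]).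

    The uniform convergence of P^n f for Lipschitz f comes from the density of
    inverse images: for every d there is an m such that the inverse image under
    T^m of any point is d-dense ([preimages_dense]).  Each average P^m f then
    contains a term close to any given value of f, and this diminishes the
    oscillation ([oscillation_decrease]).  For the density, compare two inverse
    branches of T^m that differ in their first digit only.  They end at nearly
    the same x, but their fibre coordinates differ by [gap] times (1, alpha).
    By the intermediate value theorem [gap] takes every value t of [0, 2],
    however large m is ([gap_surj]).  Chaining L such pairs produces fibre
    displacements c - B t for all B <= L at the same x ([birkhoff_ladder]), and
    the line of direction (1, alpha) is dense in the fibre ([line_dense]). *)

(** * The cosine cocycle over the inverse branches of angle doubling *)

Section cocycle.
Variable R : realType.
Implicit Types (x y : R) (b : bool) (w : seq bool).

Definition phi x : R := cos (x * (pi *+ 2)).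
Definition phi_lip : R := pi *+ 2.

Lemma phi_lip_gt0 : 0 < phi_lip.
Proof. by rewrite /phi_lip pmulrn_lgt0 // pi_gt0. Qed.

Lemma cos_lipschitz x y : `|cos x - cos y| <= `|x - y|.
Proof.
wlog xy : x y / x <= y => [H|].
  by have [/H//|/ltW/H] := leP x y; rewrite distrC [leRHS]distrC.
have [|c _ E] := @MVT_segment R (@cos R) (fun x => - sin x) _ _ xy.
  by apply: continuous_subspaceT; exact: continuous_cos.
rewrite distrC E normrM normrN [leRHS]distrC ler_piMl //; exact: sin_max.
Qed.

Lemma phi_lipschitz x y : `|phi x - phi y| <= phi_lip * `|x - y|.
Proof.
rewrite (le_trans (cos_lipschitz _ _)) // -mulrBl normrM mulrC.
by rewrite (ger0_norm (ltW phi_lip_gt0)).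
Qed.

Lemma phi_periodic (m : int) x : phi (x + m%:~R) = phi x.
Proof.
wlog [n ->] : m x / exists n : nat, m = n%:Z => [H|].
  case: m => n; first by apply: H; exists n.
  rewrite NegzE -(H n.+1 (x + _)); last by exists n.+1.
  by rewrite mulrNz addrNK.
by rewrite /phi mulrDl -pmulrn mulr_natl (periodicn (@cosD2pi R)).
Qed.

Lemma norm_phi_le1 x : `|phi x| <= 1.
Proof. exact: cos_max. Qed.

Lemma continuous_phi : continuous phi.
Proof.
move=> x; apply: (@continuous_comp _ _ _ (fun x : R => x * (pi *+ 2)) (@cos R)).
  exact: mulrr_continuous.
exact: continuous_cos.
Qed.

(** An inverse branch of angle doubling on [0, 1]; the digit [b] selects the half. *)
Definition branch b x : R := (x + b%:R) / 2.
Arguments branch : simpl never.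

Fixpoint branches w x : R :=
  if w is b :: w' then branches w' (branch b x) else x.

(** The Birkhoff sum of [phi] along the orbit of angle doubling that leads from
    [branches w x] back to [x].  The head of [w] is the digit of the inverse
    branch applied first. *)
Fixpoint birkhoff w x : R :=
  if w is b :: w' then phi (branch b x) + birkhoff w' (branch b x) else 0.

Lemma branchB b x y : branch b x - branch b y = (x - y) / 2.
Proof. rewrite /branch; lra. Qed.

Lemma branch01 b x : 0 <= x <= 1 -> 0 <= branch b x <= 1.
Proof. by rewrite /branch; case: b => /=; lra. Qed.

Lemma branches01 w x : 0 <= x <= 1 -> 0 <= branches w x <= 1.
Proof. by elim: w x => //= b w IH x /(branch01 b)/IH. Qed.

Lemma branches_cat w1 w2 x : branches (w1 ++ w2) x = branches w2 (branches w1 x).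
Proof. by elim: w1 x => //=. Qed.

Lemma birkhoff_cat w1 w2 x :
  birkhoff (w1 ++ w2) x = birkhoff w1 x + birkhoff w2 (branches w1 x).
Proof. by elim: w1 x => [|b w IH] x /=; rewrite ?add0r// IH addrA. Qed.

(** The n-th term contracts by 2^-n, so the bound is uniform in the length of
    the word: this is what makes long inverse branches controllable. *)
Lemma birkhoff_lipschitz w x y :
  `|birkhoff w x - birkhoff w y| <= phi_lip * `|x - y|.
Proof.
elim: w x y => [|b w IH] x y /=.
  by rewrite subrr normr0 mulr_ge0// ltW// phi_lip_gt0.
rewrite opprD addrACA (le_trans (ler_normD _ _)) //.
rewrite (le_trans (lerD (phi_lipschitz _ _) (IH _ _))) //.
rewrite branchB normrM (@ger0_norm _ 2^-1) ?invr_ge0 //.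
lra.
Qed.

(** The word is the binary expansion of [a], to be read backwards: the last
    digit applied is the leading one.  As all branches contract, it does not
    depend on the starting point. *)
Lemma branches_steer m a : 0 <= a <= 1 ->
  exists2 w, size w = m & forall x, 0 <= x <= 1 -> `|branches w x - a| <= (2 ^+ m)^-1.
Proof.
elim: m a => [|m IH] a a01.
  exists [::] => // x x01 /=; rewrite expr0 invr1 ler_norml; lra.
pose b := 2^-1 <= a.
have [w sw Hw] : exists2 w, size w = m & forall x, 0 <= x <= 1 ->
    `|branches w x - (2 * a - b%:R)| <= (2 ^+ m)^-1.
  by apply: IH; rewrite /b; have [ab|ab] := leP (2^-1) a => /=; lra.
exists (rcons w b); first by rewrite size_rcons sw.
move=> x /Hw; rewrite -cats1 branches_cat /= => H.
have -> : branch b (branches w x) - a = (branches w x - (2 * a - b%:R)) / 2.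
  by rewrite /branch; lra.
rewrite normrM (@ger0_norm _ 2^-1) ?invr_ge0 // exprS invfM mulrC.
by rewrite ler_pM2l ?invr_gt0.
Qed.

Lemma branches_nseq m x : branches (nseq m false) x = x / 2 ^+ m.
Proof.
elim: m x => [|m IH] x /=; first by rewrite divr1.
by rewrite IH exprS invfM /branch addr0 mulrA.
Qed.

(** From x in [0, 1], both words end within 2^-m of 0, so the difference of the
    two Birkhoff sums is a pure displacement in the fibre. *)
Definition gap m x := birkhoff (nseq m.+1 false) x - birkhoff (true :: nseq m false) x.

Lemma gap_lipschitz m x y : `|gap m x - gap m y| <= 2 * phi_lip * `|x - y|.
Proof.
rewrite /gap; set u := birkhoff (nseq _ _); set v := birkhoff (true :: _).
have -> : u x - v x - (u y - v y) = (u x - u y) + (v y - v x) by lra.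
rewrite (le_trans (ler_normD _ _)) //.
have -> : 2 * phi_lip * `|x - y| = phi_lip * `|x - y| + phi_lip * `|x - y| by lra.
by rewrite lerD ?birkhoff_lipschitz// distrC birkhoff_lipschitz.
Qed.

Lemma continuous_birkhoff w : continuous (birkhoff w).
Proof.
elim: w => [|b w IH] x /=; first exact: cvg_cst.
have cb : {for x, continuous (branch b)}.
  apply: cvgM; last exact: cvg_cst.
  by apply: cvgD; [exact: cvg_id|exact: cvg_cst].
apply: cvgD; apply: (continuous_comp cb); first exact: continuous_phi.
exact: IH.
Qed.

Lemma birkhoff_nseqE m x :
  birkhoff (nseq m false) x = \sum_(i < m) phi (x / 2 ^+ i.+1).
Proof.
elim: m x => [|m IH] x; first by rewrite big_ord0.
rewrite big_ord_recl /= IH expr1 /branch addr0; congr (_ + _).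
by apply: eq_bigr => i _; rewrite [in RHS]exprS invfM mulrA.
Qed.

Lemma gapE m x : gap m x =
  \sum_(i < m.+1) (phi (x / 2 ^+ i.+1) - phi ((x + 1) / 2 ^+ i.+1)).
Proof.
rewrite /gap birkhoff_nseqE /= birkhoff_nseqE sumrB; congr (_ - _).
rewrite big_ord_recl expr1 /branch; congr (_ + _).
by apply: eq_bigr => i _; rewrite [in RHS]exprS invfM mulrA.
Qed.

Lemma phi0 : phi 0 = 1.
Proof. by rewrite /phi mul0r cos0. Qed.

Lemma phi1 : phi 1 = 1.
Proof. by rewrite -[1 in LHS]add0r (phi_periodic 1) phi0. Qed.

Lemma phi_half : phi (1 / 2) = -1.
Proof. by rewrite /phi mul1r -(mulr_natr pi) mulrCA mulVf // mulr1 cospi. Qed.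

Lemma gap0 m : 2 <= gap m 0.
Proof.
rewrite gapE big_ord_recl expr1 mul0r add0r phi0 phi_half.
rewrite (_ : 1 - -1 = 2); last lra.
rewrite lerDl; apply: sumr_ge0 => i _; rewrite mul0r phi0 subr_ge0.
exact: cos_le1.
Qed.

(** At x = 1 the sum telescopes, since (1 + 1) / 2^(i + 1) = 1 / 2^i. *)
Lemma gap1 m : gap m 1 <= 0.
Proof.
rewrite gapE (eq_bigr (fun i : 'I_m.+1 => phi (1 / 2 ^+ i.+1) - phi (1 / 2 ^+ i))); last first.
  move=> i _; congr (_ - phi _); rewrite exprS invfM mulrA; congr (_ * _); lra.
rewrite -(big_mkord xpredT (fun i => phi (1 / 2 ^+ i.+1) - phi (1 / 2 ^+ i))).
rewrite telescope_sumr //= expr0 divr1 phi1 subr_le0; exact: cos_le1.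
Qed.

(** The bounds at the ends do not depend on [m], hence neither does the range of
    displacements, while the base points get arbitrarily close. *)
Lemma gap_surj m t : 0 <= t <= 2 -> exists2 a, 0 <= a <= 1 & gap m a = t.
Proof.
move=> /andP[t0 t2].
have c : continuous (gap m).
  by move=> x; apply: cvgB; exact: continuous_birkhoff.
have [||a] := @IVT R (gap m) 0 1 t ler01.
- exact: continuous_subspaceT.
- rewrite ge_min le_max (le_trans (gap1 m) t0) orbT.
  by rewrite (le_trans t2 (gap0 m)).
by rewrite in_itv /=; exists a.
Qed.

End cocycle.

(** * A Liouville number *)

Section liouville.
Variable R : realType.

Lemma inv_pow2_small (e : R) : 0 < e -> exists m, forall n, (m <= n)%N -> (2 ^+ n)^-1 <= e.
Proof.
move=> e0; exists (Num.bound e^-1) => n mn.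
rewrite invf_ple ?posrE ?exprn_gt0 // (le_trans (ltW (archi_boundP _)))//.
  by rewrite invr_ge0 ltW.
by rewrite -natrX ler_nat (leq_trans mn) // ltnW // ltn_expl.
Qed.

(** The growth by a factor 10 leaves room for the three scales attached to
    q = 2 ^ expo k: the target radius q^-2, the time horizon q^7 and the
    approximation error, at most 2 q^-10. *)
Definition expo k := (10 ^ k.+1)%N.

Lemma expoS k : expo k.+1 = (10 * expo k)%N.
Proof. by rewrite /expo expnS. Qed.

Lemma expo_ge k : (k + 10 <= expo k)%N.
Proof. by elim: k => // k IH; rewrite expoS; lia. Qed.

Definition liouville_sum k : R := \sum_(j < k.+1) (2 ^+ expo j)^-1.
Definition liouville : R := sup (range liouville_sum).

Lemma liouville_sumS k : liouville_sum k.+1 = liouville_sum k + (2 ^+ expo k.+1)^-1.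
Proof. by rewrite /liouville_sum big_ord_recr. Qed.

Lemma liouville_sum_le j k : liouville_sum j <= liouville_sum k + 2 / 2 ^+ expo k.+1.
Proof.
have dec i : liouville_sum i.+1 + 2 / 2 ^+ expo i.+2 <= liouville_sum i + 2 / 2 ^+ expo i.+1.
  rewrite liouville_sumS -addrA lerD2l.
  suff : 2 / 2 ^+ expo i.+2 <= ((2 : R) ^+ expo i.+1)^-1 by lra.
  have -> : expo i.+2 = ((expo i.+2).-1).+1 by have := expo_ge i.+2; lia.
  rewrite exprS invfM mulrA mulfV // mul1r lef_pV2 ?posrE ?exprn_gt0 //.
  by rewrite ler_eXn2l ?ltr1n//; have := expo_ge i.+1; rewrite (expoS i.+1); lia.
have incr i : liouville_sum i <= liouville_sum i.+1.
  by rewrite liouville_sumS lerDl invr_ge0 exprn_ge0.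
have [jk|kj] := leqP j k.
  have H : liouville_sum j <= liouville_sum k.
    by apply: (homo_leq (r := fun a b => a <= b)) jk => // ? ? ?; exact: le_trans.
  by rewrite (le_trans H) // lerDl divr_ge0 // exprn_ge0.
have H : liouville_sum j + 2 / 2 ^+ expo j.+1 <= liouville_sum k + 2 / 2 ^+ expo k.+1.
  apply: (homo_leq (f := fun i => liouville_sum i + 2 / 2 ^+ expo i.+1)
    (r := fun a b => b <= a)) (ltnW kj) => //.
  by move=> ? ? ? ab bc; exact: le_trans bc ab.
by rewrite (le_trans _ H) // lerDl divr_ge0 // exprn_ge0.
Qed.

Lemma liouville_approx k : liouville_sum k <= liouville <= liouville_sum k + 2 / 2 ^+ expo k.+1.
Proof.
have hs : has_sup (range liouville_sum).
  split; first by exists (liouville_sum 0); exists 0.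
  by exists (liouville_sum 0 + 2 / 2 ^+ expo 1) => _ [j _ <-]; exact: liouville_sum_le.
apply/andP; split; first by apply: (sup_upper_bound hs); exists k.
by apply: ge_sup; [exact: hs.1|move=> _ [j _ <-]; exact: liouville_sum_le].
Qed.

Lemma liouville01 : 0 <= liouville <= 1.
Proof.
have /andP[h1 h2] := liouville_approx 0; apply/andP; split.
  by rewrite (le_trans _ h1)// sumr_ge0 // => i _; rewrite invr_ge0 exprn_ge0.
rewrite (le_trans h2) // /liouville_sum big_ord1.
have a : ((2 : R) ^+ expo 0)^-1 <= 2^-1.
  rewrite lef_pV2 ?posrE ?exprn_gt0 // -[leLHS]expr1 ler_eXn2l ?ltr1n//.
have b : ((2 : R) ^+ expo 1)^-1 <= (2 ^+ 2)^-1.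
  by rewrite lef_pV2 ?posrE ?exprn_gt0 // ler_eXn2l ?ltr1n//.
move: a b; set u := (_ ^+ expo 0)^-1; set v := (_ ^+ expo 1)^-1; lra.
Qed.

(** The numerator is odd, so the fraction is in lowest terms; this is what the
    density of the multiples of [liouville] uses. *)
Lemma liouville_sum_frac k : exists2 p : nat, odd p & liouville_sum k = p%:R / 2 ^+ expo k.
Proof.
elim: k => [|k [p op E]].
  by exists 1%N => //; rewrite /liouville_sum big_ord1 mul1r.
exists (p * 2 ^ (9 * expo k) + 1)%N.
  rewrite addn1 /= oddM oddX orbF (_ : (9 * expo k == 0)%N = false) ?andbF //.
  by have := expo_ge k; lia.
rewrite liouville_sumS E natrD natrM natrX mulrDl mul1r; congr (_ + _).
rewrite expoS (_ : 10 * expo k = 9 * expo k + expo k)%N; last lia.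
by rewrite exprD invfM mulrA mulfK // expf_neq0.
Qed.

Lemma coprime_residue (p q : nat) (c : int) : (0 < q)%N -> coprime p q ->
  exists (n : nat) (b : int), (n < q)%N /\ n%:Z * p%:Z = c + b * q%:Z.
Proof.
move=> q0 cpq; have [u [v uv]] : exists u v : int, u * p%:Z + v * q%:Z = 1.
  have /coprimezP[[u v] /= uv] : coprimez p%:Z q%:Z by [].
  by exists u, v.
have q0' : q%:Z != 0 by lia.
have := modz_ge0 (c * u) q0'; have := ltz_pmod (c * u) (_ : 0 < q%:Z).
have := divz_eq (c * u) q%:Z.
set r := modz _ _; set d := divz _ _ => E /(_ ltac:(lia)) rq r0.
exists `|r|%N, (- (c * v) - d * p%:Z); split; first lia.
rewrite gez0_abs //.
have -> : r = c * u - d * q%:Z by rewrite E; ring.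
apply/eqP; rewrite -subr_eq0.
move: uv; clearbody d; move: (p%:Z) (q%:Z) => P Q uv.
rewrite [X in X == _](_ : _ = c * (u * P + v * Q) - c); last by ring.
by rewrite uv mulr1 subrr.
Qed.

(** The multiples n p / q with n < q run through all the multiples of 1 / q
    modulo 1, and replacing p / q by [liouville] costs less than 1 / q. *)
Lemma liouville_dense k (xi : R) : exists (n : nat) (b : int),
  (n < 2 ^ expo k)%N /\ `|n%:R * liouville - xi - b%:~R| <= 2 / 2 ^+ expo k.
Proof.
have [p op E] := liouville_sum_frac k.
set q := (2 ^ expo k)%N; have q0 : (0 < q)%N by rewrite expn_gt0.
have qR : (2 : R) ^+ expo k = q%:R by rewrite natrX.
have cpq : coprime p q by rewrite coprimeXr // coprimen2.
have [n [b [nq H]]] := coprime_residue (Num.floor (q%:R * xi)) q0 cpq.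
exists n, b; split=> //.
have := floor_itv (q%:R * xi); set c := Num.floor _ in H *; rewrite intrD1 => cb.
have {}H : n%:R * p%:R = c%:~R + b%:~R * q%:R :> R.
  by rewrite (pmulrn _ n) (pmulrn _ p) (pmulrn _ q) -!intrM -intrD H.
have q0R : 0 < q%:R :> R by rewrite ltr0n.
have h1 : `|n%:R * (p%:R / q%:R) - xi - b%:~R| <= 1 / q%:R.
  have -> : n%:R * (p%:R / q%:R) - xi - b%:~R = (c%:~R - q%:R * xi) / q%:R.
    by rewrite mulrA H; field; rewrite gt_eqF.
  by rewrite normrM normfV (gtr0_norm q0R) ler_pM2r ?invr_gt0// ler_norml; lra.
have /andP[l1 l2] := liouville_approx k; rewrite E qR in l1 l2.
have h2 : `|n%:R * (liouville - p%:R / q%:R)| <= 1 / q%:R.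
  rewrite normrM normr_nat ger0_norm ?subr_ge0//.
  apply: (@le_trans _ _ (q%:R * (2 / 2 ^+ expo k.+1))).
    apply: ler_pM; rewrite ?ler0n ?subr_ge0 ?ler_nat ?(ltnW nq)//; lra.
  rewrite ler_pdivlMr // expoS exprM.
  have -> : ((2 : R) ^+ 10) ^+ expo k = q%:R ^+ 10 by rewrite -exprM mulnC exprM qR.
  have -> : q%:R * (2 / q%:R ^+ 10) * q%:R = 2 / q%:R ^+ 8 :> R.
    by field; rewrite gt_eqF.
  rewrite ler_pdivrMr ?exprn_gt0 // mul1r -natrX ler_nat /q -expnM.
  by rewrite -{1}(expn1 2) leq_exp2l //; have := expo_ge k; lia.
have -> : n%:R * liouville - xi - b%:~R = (n%:R * (p%:R / q%:R) - xi - b%:~R)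
  + n%:R * (liouville - p%:R / q%:R) by ring.
rewrite (le_trans (ler_normD _ _)) // qR; lra.
Qed.

(** The flow line is followed until y is right, and then for whole turns in y,
    each of which rotates z by [liouville]. *)
Lemma line_dense (d : R) : 0 < d -> exists2 L : R, 0 <= L & forall dy dz,
  exists t (a b : int), [/\ 0 <= t <= L, dy + t = a%:~R &
    `|dz + liouville * t - b%:~R| <= d].
Proof.
move=> d0; have [|k0 Hk] := @inv_pow2_small (d / 2); first by rewrite divr_gt0.
have := Hk (expo k0) _; have := expo_ge k0 => e1 /(_ ltac:(lia)) e2.
exists ((2 ^ expo k0)%:R + 1); first by rewrite addr_ge0.
move=> dy dz; have := floor_itv dy; set f := Num.floor dy; rewrite intrD1 => fdy.
have [n [b [nq H]]] := liouville_dense k0 (- (dz + liouville * (f%:~R + 1 - dy))).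
exists (f%:~R + 1 - dy + n%:R), (f + 1 + n%:Z), b; split.
- have : n%:R <= (2 ^ expo k0)%:R :> R by rewrite ler_nat ltnW.
  have : 0 <= n%:R :> R by []. lra.
- by rewrite !intrD -pmulrn; ring.
- rewrite (_ : _ - _ = n%:R * liouville - - (dz + liouville * (f%:~R + 1 - dy)) -
    b%:~R); last by ring.
  by rewrite (le_trans H); lra.
Qed.

End liouville.

(** * Density of the inverse images *)

Section ladder.
Variable R : realType.
Implicit Types (x y : R) (b : bool) (w : seq bool).

Lemma birkhoff_dist_le w x y e : `|x - y| <= e ->
  `|birkhoff w x - birkhoff w y| <= phi_lip R * e.
Proof.
move=> xy; rewrite (le_trans (birkhoff_lipschitz _ _ _)) //.
by rewrite ler_wpM2l // ltW // phi_lip_gt0.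
Qed.

Lemma divr_add_mul (e C : R) : 0 < C -> e / (1 + C) + C * (e / (1 + C)) = e.
Proof. by move=> C0; field; rewrite gt_eqF // addr_gt0. Qed.

(** Each step of the induction appends a block: first steer x close to a point
    where the gap equals [t], then choose the leading digit [b] of a long word
    of zeros.  Choosing true instead of false lowers the sum by about [t].  Both
    choices bring x close to 0, so the blocks that follow contribute nearly the
    same amount, which is absorbed in [c]. *)
Lemma birkhoff_ladder (t : R) (L : nat) : 0 <= t <= 2 -> forall eta : R, 0 < eta ->
  exists m, forall x, 0 <= x <= 1 -> exists c, forall B, (B <= L)%N ->
    exists w, [/\ size w = m, branches w x <= eta &
      `|birkhoff w x - (c - B%:R * t)| <= eta].
Proof.
move=> t02; elim: L => [|L IH] eta eta0.
  have [m /(_ m (leqnn m)) Hm] := inv_pow2_small eta0.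
  exists m => x /andP[x0 x1]; exists (birkhoff (nseq m false) x) => B.
  rewrite leqn0 => /eqP ->; exists (nseq m false); split; first by rewrite size_nseq.
    by rewrite branches_nseq (le_trans _ Hm) // ler_piMl // invr_ge0 exprn_ge0.
  by rewrite mul0r subr0 subrr normr0 ltW.
have C0 := phi_lip_gt0 R; set C := phi_lip R in C0.
(* The error of the earlier blocks counts twice: directly, and through the
   starting point of the new block, where it is multiplied by [C]. *)
pose eta1 := eta / 2 / (1 + C).
have eta10 : 0 < eta1 by rewrite !divr_gt0 // addr_gt0.
have eta1E : eta1 + C * eta1 = eta / 2 by exact: divr_add_mul.
have [m0 H0] := IH _ eta10.
have [m1 H1] := inv_pow2_small eta0.
have [|m2 H2] := @inv_pow2_small R (eta / (4 * C)).
  by rewrite divr_gt0 // mulr_gt0.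
(* [m1] makes both choices of the digit end within [eta] of 0, and [m2] makes
   the steering to [a] so precise that the gap is within [eta / 2] of [t]. *)
have [a a01 Ha] := gap_surj m1 t02.
have [wa swa Hwa] := branches_steer m2 a01.
pose W b := wa ++ b :: nseq m1 false.
exists (m0 + (m2 + m1.+1))%N => x x01; have [c Hc] := H0 x x01.
exists (c + birkhoff (W false) 0) => B BL.
have sW b : size (W b) = (m2 + m1.+1)%N by rewrite size_cat swa /= size_nseq.
have bW w b : 0 <= branches w x <= 1 -> branches (w ++ W b) x <= eta.
  move=> /(branches01 wa) /(branch01 b) /andP[h0 h1].
  rewrite !branches_cat /= branches_nseq (le_trans _ (H1 m1 (leqnn _))) //.
  by rewrite ler_piMl // invr_ge0 exprn_ge0.
have [BL'|BL'] := leqP B L.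
  have [w [sw bw Hw]] := Hc B BL'.
  exists (w ++ W false); split; first by rewrite size_cat sw sW.
    by apply: bW; exact: branches01.
  rewrite birkhoff_cat.
  have : `|birkhoff (W false) (branches w x) - birkhoff (W false) 0| <= C * eta1.
    apply: birkhoff_dist_le; rewrite subr0 ger0_norm //.
    by have /andP[] := branches01 w x01.
  move: Hw; rewrite !ler_norml; lra.
have {}BL' : B = L.+1 by lia.
have [w [sw bw Hw]] := Hc L (leqnn L).
exists (w ++ W true); split; first by rewrite size_cat sw sW.
  by apply: bW; exact: branches01.
rewrite birkhoff_cat BL'.
have h1 : `|birkhoff (W true) (branches w x) - birkhoff (W true) 0| <= C * eta1.
  apply: birkhoff_dist_le; rewrite subr0 ger0_norm //.
  by have /andP[] := branches01 w x01.
have h2 : birkhoff (W true) 0 = birkhoff (W false) 0 - gap m1 (branches wa 0) :> R.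
  by rewrite !birkhoff_cat /gap; lra.
have h3 : `|gap m1 (branches wa 0) - t| <= eta / 2.
  rewrite -Ha (le_trans (gap_lipschitz _ _ _)) //.
  have : `|branches wa 0 - a| <= eta / (4 * C).
    by rewrite (le_trans (Hwa _ _)) ?lexx ?ler01 // H2.
  rewrite ler_pdivlMr ?mulr_gt0 // -/C; lra.
rewrite -[in L.+1%:R]natr1.
move: Hw h1 h3; rewrite h2 !ler_norml; lra.
Qed.

(** A ladder with small step provides the fibre displacement, and a last word
    steers x to its target; the displacement due to this word is known in
    advance because the ladder ends close to x = 0. *)
Lemma preimages_dense (d : R) : 0 < d -> exists m, forall x y z xq yq zq,
  0 <= x <= 1 -> 0 <= xq <= 1 -> exists w (a b : int),
  [/\ size w = m, `|branches w x - xq| <= d,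
      `|y - birkhoff w x - a%:~R - yq| <= d &
      `|z - liouville R * birkhoff w x - b%:~R - zq| <= d].
Proof.
move=> d0; have d3 : 0 < d / 3 by rewrite divr_gt0.
have [L0 L00 HL] := line_dense d3.
pose t := Num.min 1 (d / 3).
have t0 : 0 < t by rewrite /t lt_min ltr01.
have t1 : t <= 1 by rewrite /t ge_min lexx.
have td : t <= d / 3 by rewrite /t ge_min lexx orbT.
have C0 := phi_lip_gt0 R; set C := phi_lip R in C0.
pose eta := d / 3 / (1 + C).
have eta0 : 0 < eta by rewrite divr_gt0 // addr_gt0.
have etaE : eta + C * eta = d / 3 by exact: divr_add_mul.
have t02 : 0 <= t <= 2 by lra.
have [m1 H1] := birkhoff_ladder (Num.truncn (L0 / t)) t02 eta0.
have [m2 /(_ m2 (leqnn _)) H2] := inv_pow2_small d0.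
exists (m1 + m2)%N => x y z xq yq zq x01 xq01.
have [c Hc] := H1 x x01.
have [w' sw' Hw'] := branches_steer m2 xq01.
pose e : R := birkhoff w' 0.
have [tau [a [b [tau0L Ha Hb]]]] :=
  HL (y - c - e - yq) (z - liouville R * (c + e) - zq).
(* The time [tau] on the flow line is rounded down to a multiple of [t]. *)
pose B := Num.truncn (tau / t).
have /andP[B1 B2] : B%:R <= tau / t < B.+1%:R.
  by apply: truncn_itv; rewrite divr_ge0 ?(ltW t0) //; case/andP: tau0L.
have BL : (B <= Num.truncn (L0 / t))%N.
  by apply: le_truncn; rewrite ler_pM2r ?invr_gt0//; case/andP: tau0L.
have hB : `|tau - B%:R * t| <= t.
  move: B1 B2; rewrite ler_pdivlMr // ltr_pdivrMr // -natr1 ler_norml; lra.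
have [w [sw bw Hw]] := Hc B BL.
have w01 := branches01 w x01.
exists (w ++ w'), a, b; rewrite size_cat sw sw' branches_cat birkhoff_cat.
have hS : `|birkhoff w x + birkhoff w' (branches w x) - (c + e - tau)| <= 2 * (d / 3).
  have : `|birkhoff w' (branches w x) - e| <= C * eta.
    by apply: birkhoff_dist_le; rewrite subr0 ger0_norm //; case/andP: w01.
  move: Hw hB; rewrite !ler_norml; lra.
set S := birkhoff w x + _ in hS *.
split => //.
- exact: le_trans (Hw' _ w01) H2.
- move: hS; rewrite !ler_norml -Ha; lra.
- have hS' : `|liouville R * (S - (c + e - tau))| <= 2 * (d / 3).
    have /andP[l0 l1] := liouville01 R.
    by rewrite normrM (ger0_norm l0) (le_trans _ hS) // ler_piMl.
  move: hS' Hb; rewrite !ler_norml; lra.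
Qed.

End ladder.

(** * The transfer operator on Lipschitz functions *)

Section transfer_operator.
Variable R : realType.
Local Notation R3 := (R * R * R)%type.
Implicit Types (p q : R3) (b : bool) (w : seq bool) (u : R3 -> R).

Definition inv_branch b p : R3 :=
  let x := branch b p.1.1 in (x, p.1.2 - phi x, p.2 - liouville R * phi x).

Definition inv_branches w p : R3 :=
  (branches w p.1.1, p.1.2 - birkhoff w p.1.1, p.2 - liouville R * birkhoff w p.1.1).

Lemma inv_branches_cons b w p :
  inv_branches (b :: w) p = inv_branches w (inv_branch b p).
Proof.
rewrite /inv_branches /inv_branch /=; congr (_, _, _); first by rewrite opprD addrA.
by rewrite mulrDr opprD addrA.
Qed.

Definition transfer u p : R := (u (inv_branch false p) + u (inv_branch true p)) / 2.

(** The inverse branches are only used over [0, 1], where they map into [0, 1];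
    for y and z, periodicity is used instead. *)
Definition strip p := 0 <= p.1.1 <= 1.

Lemma strip_branch b p : strip p -> strip (inv_branch b p).
Proof. exact: branch01. Qed.

(** With the weight [2 * phi_lip] on x, the inverse branches do not increase
    distances: the halving of x pays for the shear that it induces in y and z. *)
Definition skew_dist p q :=
  2 * phi_lip R * `|p.1.1 - q.1.1| + `|p.1.2 - q.1.2| + `|p.2 - q.2|.

Definition skew_lipschitz K u := forall p q, `|u p - u q| <= K * skew_dist p q.

Definition yz_periodic (T : Type) (u : R3 -> T) := forall x y z (a b : int),
  u (x, y + a%:~R, z + b%:~R) = u (x, y, z).

Lemma inv_branch_contract b p q :
  skew_dist (inv_branch b p) (inv_branch b q) <= skew_dist p q.
Proof.
rewrite /skew_dist /inv_branch /=; set x := branch b p.1.1; set x' := branch b q.1.1.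
have C0 := phi_lip_gt0 R.
have hx : `|x - x'| = `|p.1.1 - q.1.1| / 2.
  by rewrite /x /x' branchB normrM (@ger0_norm _ 2^-1) ?invr_ge0.
have h := phi_lipschitz x x'.
have hy : `|p.1.2 - phi x - (q.1.2 - phi x')| <= `|p.1.2 - q.1.2| + `|phi x - phi x'|.
  rewrite (_ : _ - _ - _ = (p.1.2 - q.1.2) - (phi x - phi x')); last by lra.
  exact: ler_normB.
have hz : `|p.2 - liouville R * phi x - (q.2 - liouville R * phi x')| <=
    `|p.2 - q.2| + `|phi x - phi x'|.
  rewrite (_ : _ - _ - _ = (p.2 - q.2) - liouville R * (phi x - phi x')); last by lra.
  rewrite (le_trans (ler_normB _ _)) // lerD2l normrM.
  by have /andP[l0 l1] := liouville01 R; rewrite (ger0_norm l0) ler_piMl.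
by rewrite hx in h *; lra.
Qed.

Lemma transfer_lipschitz K u : 0 <= K -> skew_lipschitz K u ->
  skew_lipschitz K (transfer u).
Proof.
move=> K0 Hu p q; rewrite /transfer -mulrBl opprD addrACA normrM.
rewrite (@ger0_norm _ 2^-1) ?invr_ge0 // ler_pdivrMr // (le_trans (ler_normD _ _)) //.
rewrite mulr_natr mulr2n lerD // (le_trans (Hu _ _)) // ler_wpM2l //;
  exact: inv_branch_contract.
Qed.

Lemma transfer_yz_periodic u : yz_periodic u -> yz_periodic (transfer u).
Proof.
move=> Hu x y z a b; rewrite /transfer /inv_branch /=.
by rewrite !(addrAC _ _%:~R) !Hu.
Qed.

Lemma transfer_ge u lo : (forall p, strip p -> lo <= u p) ->
  forall p, strip p -> lo <= transfer u p.
Proof.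
move=> H p sp; have h1 := H _ (strip_branch false sp); have h2 := H _ (strip_branch true sp).
rewrite /transfer; lra.
Qed.

Lemma transfer_le u hi : (forall p, strip p -> u p <= hi) ->
  forall p, strip p -> transfer u p <= hi.
Proof.
move=> H p sp; have h1 := H _ (strip_branch false sp); have h2 := H _ (strip_branch true sp).
rewrite /transfer; lra.
Qed.

Lemma iter_transfer_itv n u lo hi : (forall p, strip p -> lo <= u p <= hi) ->
  forall p, strip p -> lo <= iter n transfer u p <= hi.
Proof.
move=> H; elim: n => //= n IH p sp; apply/andP; split.
  by apply: transfer_ge sp => q /IH/andP[].
by apply: transfer_le sp => q /IH/andP[].
Qed.

Lemma iter_transfer_lipschitz n K u : 0 <= K -> skew_lipschitz K u ->
  skew_lipschitz K (iter n transfer u).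
Proof. by move=> K0 Hu; elim: n => //= n IH; exact: transfer_lipschitz. Qed.

Lemma iter_transfer_yz_periodic n u : yz_periodic u ->
  yz_periodic (iter n transfer u).
Proof. by move=> Hu; elim: n => //= n IH; exact: transfer_yz_periodic. Qed.

(** Among the 2^m terms of the average, all are at least [lo], and one of them
    is the value at [inv_branches w p]. *)
Lemma iter_transfer_gain u lo : (forall p, strip p -> lo <= u p) ->
  forall w p, strip p ->
  lo + (u (inv_branches w p) - lo) / 2 ^+ size w <= iter (size w) transfer u p.
Proof.
move=> H; have Hn n p : strip p -> lo <= iter n transfer u p.
  by elim: n p => [|n IH] p sp; [exact: H|exact: transfer_ge].
elim=> [|b w IH] p sp.
  rewrite expr0 divr1 /= /inv_branches /= mulr0 !subr0 addrC subrK.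
  by case: p sp => -[].
rewrite inv_branches_cons -[size (b :: w)]/(size w).+1 iterS exprS invfM mulrCA.
have := IH _ (strip_branch b sp).
have := Hn (size w) _ (strip_branch (~~ b) sp).
set v := _ / _ ^+ _; set U := iter _ _ _; rewrite /transfer.
by clearbody v U; case: b => /= h h'; lra.
Qed.

Section uniform.
Variables (K eps : R) (K0 : 0 <= K) (eps0 : 0 < eps).

(** Either the upper half of the range is not taken, or it is taken at a point
    that every point nearly has among its inverse images of order m, and then
    the lower bound of the m-th average can be raised. *)
Lemma oscillation_decrease : exists2 g : R, 0 < g & forall u lo hi,
  skew_lipschitz K u -> yz_periodic u -> (forall p, strip p -> lo <= u p <= hi) ->
  eps < hi - lo -> exists n lo' hi', hi' - lo' <= hi - lo - g /\
    forall p, strip p -> lo' <= iter n transfer u p <= hi'.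
Proof.
have := phi_lip_gt0 R; have := eps0 => e0 C0.
have K1 : 0 < K + 1 by rewrite ltr_wpDl.
have C1 : 0 < 2 * phi_lip R + 2 by rewrite addr_gt0 // mulr_gt0.
pose d := eps / 8 / (K + 1) / (2 * phi_lip R + 2).
have d0 : 0 < d by rewrite !divr_gt0.
have dE : K * ((2 * phi_lip R + 2) * d) <= eps / 8.
  rewrite /d [X in K * X](_ : _ = eps / 8 / (K + 1)); last first.
    by rewrite mulrC divfK // gt_eqF.
  by rewrite mulrA ler_pdivrMr //; lra.
have [m Hm] := preimages_dense d0.
have m20 : 0 < ((2 : R) ^+ m)^-1 by rewrite invr_gt0 exprn_gt0.
have m21 : ((2 : R) ^+ m)^-1 <= 1 by rewrite invf_le1 ?exprn_gt0 // exprn_ege1 // ler1n.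
exists (eps / 4 / 2 ^+ m); first by rewrite !divr_gt0 // exprn_gt0.
move=> u lo hi uK uP ub ehl.
have [[q sq qu]|H] := pselect (exists2 q, strip q & (lo + hi) / 2 <= u q); last first.
  exists 0%N, lo, ((lo + hi) / 2); split.
    suff : eps / 4 / 2 ^+ m <= eps / 4 by lra.
    rewrite ler_piMr //; lra.
  move=> p sp; have /andP[-> _] := ub _ sp; rewrite /= leNgt; apply/negP => h.
  by apply: H; exists p => //; exact: ltW.
exists m, (lo + ((lo + hi) / 2 - eps / 8 - lo) / 2 ^+ m), hi; split.
  suff : eps / 4 / 2 ^+ m <= ((lo + hi) / 2 - eps / 8 - lo) / 2 ^+ m by lra.
  by rewrite ler_pM2r //; lra.
move=> p sp; have /andP[_ ->] := iter_transfer_itv m ub sp; rewrite andbT.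
have [w [a [b [sw hx hy hz]]]] := Hm p.1.1 p.1.2 p.2 q.1.1 q.1.2 q.2 sp sq.
have := iter_transfer_gain (fun p sp => proj1 (andP (ub p sp))) w sp; rewrite sw.
apply: le_trans; rewrite lerD2l ler_pM2r // lerD2r.
have -> : u (inv_branches w p) = u (branches w p.1.1,
    p.1.2 - birkhoff w p.1.1 + (- a)%:~R, p.2 - liouville R * birkhoff w p.1.1 + (- b)%:~R).
  by rewrite uP.
set p' := (_, _, _); have := uK q p'.
have : K * skew_dist q p' <= K * ((2 * phi_lip R + 2) * d).
  rewrite ler_wpM2l // /skew_dist /p' /= !intrN.
  have : 2 * phi_lip R * `|branches w p.1.1 - q.1.1| <= 2 * phi_lip R * d.
    by rewrite ler_wpM2l // mulr_ge0 // ltW.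
  rewrite (distrC q.1.1) (distrC q.1.2) (distrC q.2); lra.
rewrite ler_norml; lra.
Qed.

(** As long as the oscillation exceeds [eps] it decreases by a fixed amount, so
    this happens finitely often. *)
Lemma iter_transfer_cvg u lo hi : skew_lipschitz K u -> yz_periodic u ->
  (forall p, strip p -> lo <= u p <= hi) ->
  exists N c, forall n p, (N <= n)%N -> strip p -> `|iter n transfer u p - c| <= eps.
Proof.
have [g g0 step] := oscillation_decrease => uK uP ub; have := eps0 => e0.
suff [N [lo' [hi' [hl H]]]] : exists N lo' hi', hi' - lo' <= eps /\
    forall p, strip p -> lo' <= iter N transfer u p <= hi'.
  exists N, lo' => n p Nn sp; have := iter_transfer_itv (n - N) H sp.
  by rewrite -iterD subnK // ler_norml; lra.
have : hi - lo <= eps + g * (Num.bound ((hi - lo) / g))%:R.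
  have lohi : 0 <= (hi - lo) / g.
    have s0 : strip (0 : R3) by rewrite /strip lexx ler01.
    by rewrite divr_ge0 ?(ltW g0) // subr_ge0; case/andP: (ub _ s0); exact: le_trans.
  by have := archi_boundP lohi; rewrite ltr_pdivrMr //; lra.
move: (Num.bound ((hi - lo) / g)) => j; elim: j u lo hi uK uP ub => [|j IH] u lo hi uK uP ub hl.
  by exists 0%N, lo, hi; split=> //; lra.
have [h|h] := leP (hi - lo) eps; first by exists 0%N, lo, hi.
have [n [lo1 [hi1 [hl1 H1]]]] := step _ _ _ uK uP ub h.
have [|N [lo2 [hi2 [hl2 H2]]]] := IH _ _ _ (iter_transfer_lipschitz n K0 uK)
  (iter_transfer_yz_periodic n uP) H1.
  rewrite -natr1 in hl; lra.
exists (N + n)%N, lo2, hi2; split=> // p sp.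
by rewrite iterD H2.
Qed.

End uniform.
End transfer_operator.

(** * Integration over the circle and over the unit cube *)

Section affine_substitution.
Variable R : realType.
Local Notation mR := (measurableTypeR R).
Local Notation mu := (@lebesgue_measure R).
Variables (a c : R) (a0 : 0 < a).

Let tau (x : mR) : mR := a * x + c.

Let mtau : measurable_fun setT tau.
Proof. by apply: measurable_funD => //; exact: measurable_funM. Qed.
Let anng : {nonneg R} := NngNum (ltW a0).
Let nu : {measure set mR -> \bar R} := mscale anng
  (measure_function_pushforward__canonical__measure_function_Measure mu mtau).

Lemma lebesgue_measure_affine (A : set mR) : measurable A -> mu A = nu A.
Proof.
apply: lebesgue_measure_unique => _ [[x y] _ <-].
rewrite /nu /mscale /= /pushforward.
rewrite [X in _ = (_ * lebesgue_measure X)%E](_ : _ =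
  `](x - c) / a, (y - c) / a]%classic); last first.
  apply/seteqP; split => z /=; rewrite !in_itv /= /tau ltr_pdivrMr // ler_pdivlMr //;
  rewrite (mulrC z); lra.
rewrite !lebesgue_measure_itv /= !lte_fin ltr_pM2r ?invr_gt0 // ltrD2r.
case: ifP => _; last by rewrite mule0.
rewrite -!EFinB -EFinM; congr EFin; field; rewrite gt_eqF //.
Qed.

Lemma ge0_integral_affine (f : R -> \bar R) p q p' q' :
  measurable_fun (setT : set mR) f -> (forall x, (0 <= f x)%E) ->
  p' = a * p + c -> q' = a * q + c ->
  (\int[mu]_(x in `[p', q'[) f x = a%:E * \int[mu]_(x in `[p, q[) f (a * x + c)%R)%E.
Proof.
move=> mf f0 -> ->; rewrite (eq_measure_integral nu); last first.
  by move=> A mA _; exact: lebesgue_measure_affine.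
rewrite ge0_integral_mscale //; last exact: measurable_funTS.
congr (_ * _)%E; rewrite ge0_integral_pushforward //; last exact: measurable_funTS.
rewrite (_ : _ @^-1` _ = `[p, q[%classic) //.
apply/seteqP; split => z /=; rewrite !in_itv /= /tau lerD2r ltrD2r ler_pM2l // ltr_pM2l //.
Qed.

End affine_substitution.

Section circle_integrals.
Variable R : realType.
Local Notation mR := (measurableTypeR R).
Local Notation mu := (@lebesgue_measure R).
Variables (f : mR -> \bar R) (mf : measurable_fun setT f) (f0 : forall x, (0 <= f x)%E).

Lemma ge0_integral_itv_split (p q r : R) : p <= q -> q <= r ->
  (\int[mu]_(x in `[p, r[) f x = \int[mu]_(x in `[p, q[) f x + \int[mu]_(x in `[q, r[) f x)%E.
Proof.
move=> pq qr; rewrite -ge0_integral_setU //; last 2 first.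
- exact: measurable_funTS.
- rewrite disj_set2E; apply/eqP/seteqP; split => // x /= []; rewrite !in_itv /=; lra.
congr (integral _ _ _); apply/seteqP; split => x /=; rewrite !in_itv /=.
  by move=> h; have [xq|xq] := ltP x q; [left|right]; lra.
by case; lra.
Qed.

Lemma ge0_integral_periodic_shift (c : R) : (forall x (m : int), f (x + m%:~R) = f x) ->
  (\int[mu]_(x in `[0%R, 1%R[) f (x - c)%R = \int[mu]_(x in `[0%R, 1%R[) f x)%E.
Proof.
move=> per; wlog c01 : c / 0 <= c < 1 => [H|].
  rewrite -(H (c - (Num.floor c)%:~R)); last first.
    by have := floor_itv c; rewrite intrD1; lra.
  by apply: eq_integral => x _; rewrite opprB addrCA addrC per.
have translate (p q e : R) : (\int[mu]_(x in `[(p + e)%R, (q + e)%R[) f x =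
    \int[mu]_(x in `[p, q[) f (x + e)%R)%E.
  rewrite (@ge0_integral_affine R 1 e ltr01 f p q) ?mul1r // mul1e.
  by apply: eq_integral => x _; rewrite mul1r.
rewrite -translate add0r (@ge0_integral_itv_split _ 0) //; [|lra|lra].
have := translate (- c) 0 1; rewrite add0r => E2.
rewrite [X in (X + _)%E](_ : _ = \int[mu]_(x in `[(- c + 1)%R, 1%R[) f x)%E; last first.
  by rewrite E2; apply: eq_integral => x _; rewrite (per x 1).
rewrite addeC (addrC (- c)) -ge0_integral_itv_split //; lra.
Qed.

Lemma ge0_integral_doubling :
  (\int[mu]_(x in `[0%R, 1%R[) f (branch false x) +
   \int[mu]_(x in `[0%R, 1%R[) f (branch true x) =
   2%:E * \int[mu]_(x in `[0%R, 1%R[) f x)%E.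
Proof.
have h0 : 0 < (2^-1 : R) by rewrite invr_gt0.
have h1 : (2^-1 : R) < 1 by lra.
rewrite (@ge0_integral_itv_split 0 2^-1 1) ?ltW //.
rewrite (@ge0_integral_affine R 2^-1 0 h0 f 0 1 0 2^-1) //; [|by lra..].
rewrite (@ge0_integral_affine R 2^-1 2^-1 h0 f 0 1 2^-1 1) //; [|by lra..].
rewrite -ge0_muleDr ?integral_ge0 // muleA -EFinM mulfV // mul1e.
congr (_ + _)%E; apply: eq_integral => x _; congr f; rewrite /branch /=; lra.
Qed.

End circle_integrals.

Section prod_integral.
Context d1 d2 (T1 : measurableType d1) (T2 : measurableType d2) (R : realType).
Variables (m1 : {sigma_finite_measure set T1 -> \bar R})
          (m2 : {sigma_finite_measure set T2 -> \bar R}).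

Lemma ge0_integral_setX (A : set T1) (B : set T2) (f : T1 * T2 -> \bar R) :
  measurable A -> measurable B -> measurable_fun setT f -> (forall x, (0 <= f x)%E) ->
  (\int[m1 \x m2]_(p in A `*` B) f p = \int[m1]_(x in A) \int[m2]_(y in B) f (x, y))%E.
Proof.
move=> mA mB mf f0; rewrite integral_mkcond fubini_tonelli1; last 2 first.
- by apply/(measurable_restrictT f (measurableX mA mB)); exact: measurable_funTS.
- by move=> x; rewrite /patch; case: ifP.
rewrite [RHS]integral_mkcond; apply: eq_integral => x _.
rewrite /fubini_F /patch; case: ifPn => xA.
  rewrite [RHS]integral_mkcond; apply: eq_integral => y _; rewrite /patch.
  by rewrite in_setX xA.
by rewrite integral0_eq // => y _; rewrite in_setX (negbTE xA).
Qed.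

Lemma measurable_integral_section (B : set T2) (f : T1 * T2 -> \bar R) :
  measurable B -> measurable_fun setT f -> (forall x, (0 <= f x)%E) ->
  measurable_fun setT (fun x => \int[m2]_(y in B) f (x, y))%E.
Proof.
move=> mB mf f0.
have := @measurable_fun_fubini_tonelli_F _ _ _ _ R m2 (f \_ (setT `*` B)).
rewrite (_ : fubini_F _ _ = (fun x => \int[m2]_(y in B) f (x, y))%E); last first.
  apply/funext => x; rewrite /fubini_F [RHS]integral_mkcond.
  by apply: eq_integral => y _; rewrite /patch in_setX in_setT.
apply; last by move=> x; rewrite /patch; case: ifP.
by apply/(measurable_restrictT f (measurableX measurableT mB)); exact: measurable_funTS.
Qed.

End prod_integral.

Section cube_integral.
Variable R : realType.
Local Notation mR := (measurableTypeR R).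
Local Notation R3 := (mR * mR * mR)%type.
Local Notation mu := (@lebesgue_measure R).
Implicit Types (u : R3 -> \bar R).

Let plane_sigma_finite : sigma_finite setT (mu \x mu)%E.
Proof.
have /sigma_finiteP[F [TF ndF Foo]] := sigma_finiteT mu.
exists (fun n => F n `*` F n).
  rewrite -setXTT TF predeqE => -[x y]; split.
    move=> [/= [n _ Fnx] [k _ Fky]]; exists (maxn n k) => //; split.
    - by move: x Fnx; exact/subsetPset/ndF/leq_maxl.
    - by move: y Fky; exact/subsetPset/ndF/leq_maxr.
  by move=> [n _ []/= ? ?]; split; exists n.
move=> k; have [? ?] := Foo k; split; first exact: measurableX.
by rewrite product_measure1E// lte_mul_pinfty// ge0_fin_numE.
Qed.

Let plane_mixin :=
  @Measure_isSigmaFinite.Build _ (mR * mR)%type R (mu \x mu)%E plane_sigma_finite.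
(* Packaged as a sigma-finite measure, the product can serve again as the
   left factor in Tonelli for the triple product. *)
Let plane : {sigma_finite_measure set (mR * mR)%type -> \bar R} :=
  HB.pack (mu \x mu)%E plane_mixin.

Lemma ge0_integral_cube u : measurable_fun setT u -> (forall p, (0 <= u p)%E) ->
  (\int[@lebesgue3 R]_(p in @unit_cube R) u p =
   \int[mu]_(x in `[0%R, 1%R[) \int[mu]_(y in `[0%R, 1%R[) \int[mu]_(z in `[0%R, 1%R[)
     u (x, y, z))%E.
Proof.
move=> mu_ u0.
have mI : measurable (`[0%R, 1%R[%classic : set mR) by exact: measurable_itv.
have mII := measurableX mI mI.
have E1 := ge0_integral_setX plane mu mII mI mu_ u0.
pose v (xy : mR * mR) := (\int[mu]_(z in `[0%R, 1%R[) u (xy, z))%E.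
have mv : measurable_fun setT v by exact: (measurable_integral_section mu mI mu_ u0).
have v0 xy : (0 <= v xy)%E by exact: integral_ge0.
have E2 := ge0_integral_setX mu mu mI mI mv v0.
exact: etrans E1 E2.
Qed.

Lemma measurable_coord1 : measurable_fun setT (fun p : R3 => p.1.1).
Proof. exact: measurableT_comp measurable_fst measurable_fst. Qed.

Lemma measurable_coord2 : measurable_fun setT (fun p : R3 => p.1.2).
Proof. exact: measurableT_comp measurable_snd measurable_fst. Qed.

Lemma measurable_superlevel (f : R3 -> R) (a : R) : measurable_fun setT f ->
  measurable [set p | a < f p].
Proof.
move=> mf; rewrite (_ : [set _ | _] = setT `&` f @^-1` `]a, +oo[).
  by apply: mf => //; exact: measurable_itv.
by apply/seteqP; split => p; rewrite /= in_itv /= andbT; [split|case].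
Qed.

Lemma measurable_phi : measurable_fun setT (@phi R : mR -> mR).
Proof. exact: continuous_measurable_fun (@continuous_phi R). Qed.

Lemma measurable_branch b : measurable_fun setT (@branch R b : mR -> mR).
Proof. by apply: measurable_funM => //; exact: measurable_funD. Qed.

Lemma measurable_inv_branch b : measurable_fun setT (@inv_branch R b : R3 -> R3).
Proof.
have mb := measurableT_comp (measurable_branch b) measurable_coord1.
have mp := measurableT_comp measurable_phi mb.
apply: measurable_fun_pair; first apply: measurable_fun_pair => //.
  by apply: measurable_funB => //; exact: measurable_coord2.
apply: measurable_funB; first exact: measurable_snd.
exact: measurable_funM.
Qed.

(** The translation in the fibre is absorbed by periodicity in y and z, and the
    remaining function of x by the change of variable that doubles x. *)
Lemma ge0_integral_cube_inv_branches u : measurable_fun setT u ->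
  (forall p, (0 <= u p)%E) -> yz_periodic u ->
  (\int[@lebesgue3 R]_(p in @unit_cube R) u (inv_branch false p) +
   \int[@lebesgue3 R]_(p in @unit_cube R) u (inv_branch true p) =
   2%:E * \int[@lebesgue3 R]_(p in @unit_cube R) u p)%E.
Proof.
move=> mu_ u0 per.
pose J (x y : mR) := (\int[mu]_(z in `[0%R, 1%R[) u (x, y, z))%E.
pose H (x : mR) := (\int[mu]_(y in `[0%R, 1%R[) J x y)%E.
have mI : measurable (`[0%R, 1%R[%classic : set mR) by exact: measurable_itv.
have J0 x y : (0 <= J x y)%E by exact: integral_ge0.
have mJ : measurable_fun setT (fun xy : mR * mR => J xy.1 xy.2).
  have -> : (fun xy : mR * mR => J xy.1 xy.2) =
      (fun xy => \int[mu]_(z in `[0%R, 1%R[) u (xy, z))%E by apply/funext => -[].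
  exact: measurable_integral_section.
have mH : measurable_fun setT H.
  exact: (measurable_integral_section mu mI mJ).
have H0 x : (0 <= H x)%E by exact: integral_ge0.
have E b : (\int[@lebesgue3 R]_(p in @unit_cube R) u (inv_branch b p) =
    \int[mu]_(x in `[0%R, 1%R[) H (branch b x))%E.
  have mub := measurableT_comp mu_ (measurable_inv_branch b).
  apply: (etrans (ge0_integral_cube mub (fun p => u0 _))).
  apply: eq_integral => x _.
  set x' := branch b x.
  have := @ge0_integral_periodic_shift R (J x') _ (J0 x') (phi x').
  rewrite -/(H x') => <-.
  - apply: eq_integral => y _; rewrite /J.
    have := @ge0_integral_periodic_shift R (fun z => u (x', y - phi x', z)) _ _
      (liouville R * phi x').
    apply => //.
    + exact: (measurableT_comp mu_ (measurable_fun_pair _ _)).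
    + by move=> z m; have := per x' (y - phi x') z 0 m; rewrite addr0.
  - exact: (measurableT_comp mJ (pair1_measurable _)).
  - move=> y m; apply: eq_integral => z _.
    by have := per x' y z m 0; rewrite addr0.
rewrite !E ge0_integral_doubling //; congr (_ * _)%E.
exact/esym/ge0_integral_cube.
Qed.

End cube_integral.

(** * The skew product on the torus *)

Section torus_map.
Variable R : realType.
Local Notation mR := (measurableTypeR R).
Local Notation R3 := (mR * mR * mR)%type.
Local Notation lambda3 := (@lebesgue3 R).
Local Notation cube := (@unit_cube R).
Local Notation proj := (@torus_pi R : R3 -> torus R).
Local Notation haar := (@haar R).

Definition skew_map (p : R * R * R) : R * R * R :=
  (2 * p.1.1, p.1.2 + phi p.1.1, p.2 + liouville R * phi p.1.1).

Definition torus_map (q : torus R) : torus R :=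
  torus_pi (skew_map (repr (q : {eq_quot (@torus_eqv R)}%qT))).

Lemma torus_pi_shift (p : R * R * R) (a b c : int) :
  torus_pi (p.1.1 + a%:~R, p.1.2 + b%:~R, p.2 + c%:~R) = torus_pi p.
Proof.
case: p => -[x y] z; apply/torus_pi_eq; rewrite /int_vector /=.
by rewrite !(addrAC _ _%:~R) !subrr !add0r; apply/and3P; split; exact: intr_int.
Qed.

(** The choice of a representative does not matter, because [phi] is periodic. *)
Lemma torus_mapE (p : R * R * R) : torus_map (torus_pi p) = torus_pi (skew_map p).
Proof.
rewrite /torus_map; set p' := repr _.
have : torus_pi p' = torus_pi p by exact: reprK.
move=> /torus_pi_eq /and3P[/intrP[a Ea] /intrP[b Eb] /intrP[c Ec]].
have Ep : p' = (p.1.1 + a%:~R, p.1.2 + b%:~R, p.2 + c%:~R).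
  rewrite -Ea -Eb -Ec; case: p' {Ea Eb Ec} => -[x y] z /=; congr (_, _, _); lra.
rewrite Ep -(torus_pi_shift (skew_map p) (2 * a) b c); congr torus_pi.
by rewrite /skew_map /= phi_periodic intrM; congr (_, _, _); ring.
Qed.

Lemma iter_torus_mapE n (p : R * R * R) :
  iter n torus_map (torus_pi p) = torus_pi (iter n skew_map p).
Proof. by elim: n => //= n ->; rewrite torus_mapE. Qed.

Lemma torus_map_inv_branch b p :
  torus_map (torus_pi (inv_branch b p)) = torus_pi p.
Proof.
rewrite torus_mapE -(torus_pi_shift p b%:Z 0 0); congr torus_pi.
rewrite /skew_map /inv_branch /= !addrNK !addr0 /branch mulrC divfK // -pmulrn //.
Qed.

Lemma measurable_skew_map : measurable_fun setT (skew_map : R3 -> R3).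
Proof.
have mp := measurableT_comp (@measurable_phi R) (@measurable_coord1 R).
apply: measurable_fun_pair; first apply: measurable_fun_pair.
- by apply: measurable_funM => //; exact: measurable_coord1.
- by apply: measurable_funD => //; exact: measurable_coord2.
- apply: measurable_funD; first exact: measurable_snd.
  exact: measurable_funM.
Qed.

Lemma measurable_torus_map : measurable_fun setT torus_map.
Proof.
move=> _ A mA; rewrite setTI.
suff : measurable (proj @^-1` (torus_map @^-1` A) : set R3) by [].
rewrite (_ : _ @^-1` _ = skew_map @^-1` (proj @^-1` A)); last first.
  by apply/seteqP; split => p /=; rewrite torus_mapE.
by rewrite -[X in measurable X]setTI; exact: measurable_skew_map.
Qed.

Lemma measurable_iter_torus_map n : measurable_fun setT (iter n torus_map).
Proof.
elim: n => [|n IH] /=; first exact: measurable_id.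
exact: measurableT_comp measurable_torus_map IH.
Qed.

Lemma measurable_iter_preimage n A : measurable A ->
  measurable (iter n torus_map @^-1` A).
Proof.
by move=> mA; rewrite -[X in measurable X]setTI; exact: measurable_iter_torus_map.
Qed.

Lemma cube_strip p : cube p -> strip p.
Proof. by move=> [[/= + _] _]; rewrite /strip in_itv /=; lra. Qed.

(** The integral over [B] of the function induced by [f] on the fundamental
    domain. *)
Definition corr (f : R3 -> R) (B : set (torus R)) : R :=
  fine (\int[lambda3]_(p in cube) (f p * \1_(proj @^-1` B) p)%:E)%E.

Definition mass (B : set (torus R)) : R := fine (haar B).

Lemma measurable_EFin_indic (f : R3 -> R) (B : set (torus R)) :
  measurable_fun setT f -> measurable B ->
  measurable_fun setT (fun p => (f p * \1_(proj @^-1` B) p)%:E).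
Proof.
by move=> mf mB; apply/measurable_EFinP; apply: measurable_funM.
Qed.

Lemma integral_cube_indic (B : set (torus R)) : measurable B ->
  (\int[lambda3]_(p in cube) (\1_(proj @^-1` B) p)%:E = haar B)%E.
Proof. by move=> mB; rewrite integral_indic //; exact: measurable_unit_cube. Qed.

Lemma haar_fineE B : measurable B -> haar B = (mass B)%:E.
Proof.
move=> mB; rewrite /mass fineK // fin_num_abs.
by rewrite gee0_abs ?measure_ge0 // (le_lt_trans (probability_le1 (haar) mB)) // ltry.
Qed.

Lemma mass_ge0 B : 0 <= mass B.
Proof. by rewrite /mass fine_ge0 // haar_ge0. Qed.

Lemma mass_le1 B : measurable B -> mass B <= 1.
Proof. by move=> mB; rewrite -lee_fin -haar_fineE // probability_le1. Qed.

Lemma corr_itv (f : R3 -> R) B lo hi : measurable_fun setT f -> measurable B ->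
  0 <= lo -> (forall p, cube p -> lo <= f p <= hi) ->
  (\int[lambda3]_(p in cube) (f p * \1_(proj @^-1` B) p)%:E = (corr f B)%:E)%E /\
  lo * mass B <= corr f B <= hi * mass B.
Proof.
move=> mf mB lo0 fb; have mfB := measurable_EFin_indic mf mB.
have int_cst (k : R) : 0 <= k ->
    (\int[lambda3]_(p in cube) (k * \1_(proj @^-1` B) p)%:E = (k * mass B)%:E)%E.
  move=> k0; under eq_integral do rewrite EFinM.
  rewrite ge0_integralZl //; [|exact: measurable_unit_cube|].
  - by rewrite integral_cube_indic // haar_fineE // -EFinM.
  - by apply: measurable_funTS; apply/measurable_EFinP; exact: measurable_indic.
have hi0 : 0 <= hi.
  have /fb : cube (0, 0, 0) by split; [split|]; rewrite /= in_itv /= lexx ltr01.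
  by move=> /andP[]; lra.
have ind0 p : 0 <= \1_(proj @^-1` B) p :> R by rewrite indicE.
have h1 : ((lo * mass B)%:E <= \int[lambda3]_(p in cube) (f p * \1_(proj @^-1` B) p)%:E)%E.
  rewrite -int_cst //; apply: ge0_le_integral; first exact: measurable_unit_cube.
  - by move=> p _; rewrite lee_fin mulr_ge0.
  - exact: measurable_funTS (measurable_EFin_indic (measurable_cst _) mB).
  - exact: measurable_funTS.
  - by move=> p /fb/andP[h _]; rewrite lee_fin ler_wpM2r.
have h2 : (\int[lambda3]_(p in cube) (f p * \1_(proj @^-1` B) p)%:E <= (hi * mass B)%:E)%E.
  rewrite -int_cst //; apply: ge0_le_integral; first exact: measurable_unit_cube.
  - by move=> p /fb/andP[h _]; rewrite lee_fin mulr_ge0 // (le_trans lo0).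
  - exact: measurable_funTS.
  - exact: measurable_funTS (measurable_EFin_indic (measurable_cst _) mB).
  - by move=> p /fb/andP[_ h]; rewrite lee_fin ler_wpM2r.
have E : (\int[lambda3]_(p in cube) (f p * \1_(proj @^-1` B) p)%:E = (corr f B)%:E)%E.
  rewrite /corr fineK // fin_real //.
  by rewrite (lt_le_trans _ h1) ?ltNyr //= (le_lt_trans h2) ?ltry.
by split=> //; rewrite -!lee_fin -E h1 h2.
Qed.

End torus_map.

(** * Duality, and exactness on Lipschitz functions *)

Section exactness.
Variable R : realType.
Local Notation mR := (measurableTypeR R).
Local Notation R3 := (mR * mR * mR)%type.
Local Notation lambda3 := (@lebesgue3 R).
Local Notation cube := (@unit_cube R).
Local Notation proj := (@torus_pi R : R3 -> torus R).
Local Notation haar := (@haar R).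
Local Notation T := (@torus_map R).

Lemma measurable_transfer (f : R3 -> R) : measurable_fun setT f ->
  measurable_fun setT (transfer f : R3 -> R).
Proof.
move=> mf; apply: measurable_funM => //; apply: measurable_funD.
- exact: measurableT_comp mf (@measurable_inv_branch R false).
- exact: measurableT_comp mf (@measurable_inv_branch R true).
Qed.

Lemma proj_skew_map_yz (x y z : R) (a b : int) :
  torus_pi (skew_map (x, y + a%:~R, z + b%:~R)) = torus_pi (skew_map (x, y, z)).
Proof.
rewrite -!torus_mapE; congr torus_map.
by rewrite -[RHS](torus_pi_shift (x, y, z) 0 a b) /= addr0.
Qed.

(** Both sides come from integrating f times the indicator of the inverse image
    of B: composed with an inverse branch, this indicator becomes that of B. *)
Lemma transfer_duality (f : R3 -> R) (B : set (torus R)) :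
  measurable_fun setT f -> (forall p, 0 <= f p) -> yz_periodic f -> measurable B ->
  corr f (T @^-1` B) = corr (transfer f) B.
Proof.
move=> mf f0 fper mB.
have mTB : measurable (T @^-1` B) by exact: (measurable_iter_preimage 1 mB).
pose u p := (f p * \1_(proj @^-1` (T @^-1` B)) p)%:E.
have mu_ : measurable_fun setT u by exact: measurable_EFin_indic.
have ind0 (A : set R3) p : 0 <= \1_A p :> R by rewrite indicE.
have u0 p : (0 <= u p)%E by rewrite lee_fin mulr_ge0.
have uper : yz_periodic u.
  move=> x y z a b; rewrite /u fper; congr (_ * _)%:E.
  rewrite !indicE; congr (_ %:R); congr nat_of_bool.
  by apply/idP/idP; rewrite !inE /= !torus_mapE proj_skew_map_yz.
have := ge0_integral_cube_inv_branches mu_ u0 uper.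
have ub b p : u (inv_branch b p) = (f (inv_branch b p) * \1_(proj @^-1` B) p)%:E.
  rewrite /u; congr (_ * _)%:E; rewrite !indicE; congr (_ %:R); congr nat_of_bool.
  by apply/idP/idP; rewrite !inE /= torus_map_inv_branch.
have mfb b : measurable_fun setT (fun p => f (inv_branch b p)).
  exact: measurableT_comp mf (@measurable_inv_branch R b).
rewrite -ge0_integralD; last 5 first.
- exact: measurable_unit_cube.
- by move=> p _; exact: u0.
- exact: measurable_funTS (measurableT_comp mu_ (@measurable_inv_branch R false)).
- by move=> p _; exact: u0.
- exact: measurable_funTS (measurableT_comp mu_ (@measurable_inv_branch R true)).
rewrite (eq_integral (fun p : R3 => 2%:E * (transfer f p * \1_(proj @^-1` B) p)%:E)%E); last first.
  move=> p _; rewrite !ub -EFinD -EFinM /transfer; congr EFin.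
  by field.
have tf0 p : 0 <= transfer f p by rewrite /transfer divr_ge0 // addr_ge0.
rewrite ge0_integralZl //; last 3 first.
- exact: measurable_unit_cube.
- exact: measurable_funTS (measurable_EFin_indic (measurable_transfer mf) mB).
- by move=> p _; rewrite lee_fin mulr_ge0.
move=> /(congr1 (fun x => (2^-1%:E * x)%E)).
by rewrite !muleA -EFinM mulVf // !mul1e /corr => ->.
Qed.

Lemma measurable_iter_transfer n (f : R3 -> R) : measurable_fun setT f ->
  measurable_fun setT (iter n (@transfer R) f : R3 -> R).
Proof. by move=> mf; elim: n => //= n; exact: measurable_transfer. Qed.

Lemma iter_transfer_ge0 n (f : R3 -> R) p : (forall p, 0 <= f p) ->
  0 <= iter n (@transfer R) f p.
Proof.
by move=> f0; elim: n p => //= n IH p; rewrite /transfer divr_ge0 // addr_ge0.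
Qed.

Lemma iter_transfer_duality n (f : R3 -> R) (B : set (torus R)) :
  measurable_fun setT f -> (forall p, 0 <= f p) -> yz_periodic f -> measurable B ->
  corr f (iter n T @^-1` B) = corr (iter n (@transfer R) f) B.
Proof.
move=> mf f0 fper; elim: n B => // n IH B mB.
have mTB : measurable (T @^-1` B) by exact: (measurable_iter_preimage 1 mB).
rewrite (_ : iter n.+1 T @^-1` B = iter n T @^-1` (T @^-1` B)) // IH //.
rewrite transfer_duality //.
- exact: measurable_iter_transfer.
- by move=> p; exact: iter_transfer_ge0.
- exact: iter_transfer_yz_periodic.
Qed.

Lemma measure_preserving_torus_map : measure_preserving haar T.
Proof.
split=> [|A mA]; first exact: measurable_torus_map.
have mTA : measurable (T @^-1` A) by exact: (measurable_iter_preimage 1 mA).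
have corr1 B : measurable B -> corr (cst 1) B = mass B.
  move=> mB; rewrite /corr; under eq_integral do rewrite mul1r.
  by rewrite integral_cube_indic.
have t1 : transfer (cst 1) = cst 1 :> (R3 -> R).
  by apply/funext => p; rewrite /transfer /=; lra.
have h := @transfer_duality (cst 1) A (measurable_cst _) (fun=> ler01)
  (fun _ _ _ _ _ => erefl) mA.
rewrite t1 (corr1 _ _ mTA) (corr1 _ _ mA) in h.
by rewrite (haar_fineE mTA) h -(haar_fineE mA).
Qed.

(** The bound is uniform in [B].  This is equivalent to the convergence of the
    iterated transfer operator in L^1, and gives mixing of all orders at once. *)
Definition exact_fun (f : R3 -> R) := forall e : R, 0 < e -> exists N, forall n B,
  (N <= n)%N -> measurable B ->
  `|corr f (iter n T @^-1` B) - corr f setT * mass B| <= e.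

Lemma mass_setT : mass (setT : set (torus R)) = 1.
Proof. by rewrite /mass haar_setT. Qed.

Lemma lipschitz_exact (K : R) (f : R3 -> R) : measurable_fun setT f ->
  (forall p, 0 <= f p <= 1) -> yz_periodic f -> 0 <= K -> skew_lipschitz K f ->
  exact_fun f.
Proof.
move=> mf f01 fper K0 fK e e0.
have f0 p : 0 <= f p by case/andP: (f01 p).
have e2 : 0 < e / 2 by rewrite divr_gt0.
have [N [c Nc]] := iter_transfer_cvg K0 e2 fK fper (fun p _ => f01 p).
exists N => n B Nn mB.
have bounds A : measurable A ->
    (c - e / 2) * mass A <= corr f (iter n T @^-1` A) <= (c + e / 2) * mass A.
  move=> mA; rewrite iter_transfer_duality //.
  have mg := measurable_iter_transfer n mf.
  have g0 p : 0 <= iter n (@transfer R) f p by exact: iter_transfer_ge0.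
  have gc p : cube p -> Num.max 0 (c - e / 2) <= iter n (@transfer R) f p <= c + e / 2.
    move=> /cube_strip /(Nc _ _ Nn); rewrite ge_max g0 ler_norml; lra.
  (* The lower bound is truncated at 0, since [corr_itv] is about
     nonnegative functions. *)
  have m0 : 0 <= Num.max 0 (c - e / 2) by rewrite le_max lexx.
  have [_ /andP[h1 ->]] := corr_itv mg mA m0 gc; rewrite andbT (le_trans _ h1) //.
  by rewrite ler_wpM2r ?mass_ge0 // le_max lexx orbT.
have := bounds _ mB; have := bounds _ measurableT.
rewrite preimage_setT mass_setT !mulr1 => /andP[a1 a2] /andP[b1 b2].
have m0 := mass_ge0 B; have m1 := mass_le1 mB.
have h1 : corr f setT * mass B <= (c + e / 2) * mass B by rewrite ler_wpM2r.
have h2 : (c - e / 2) * mass B <= corr f setT * mass B by rewrite ler_wpM2r.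
have h3 : e * mass B <= e by rewrite ler_piMr // ltW.
rewrite ler_norml; lra.
Qed.

End exactness.

(** * Exactness on indicator functions *)

Section exactness_closure.
Variable R : realType.
Local Notation mR := (measurableTypeR R).
Local Notation R3 := (mR * mR * mR)%type.
Local Notation lambda3 := (@lebesgue3 R).
Local Notation cube := (@unit_cube R).
Local Notation proj := (@torus_pi R : R3 -> torus R).
Local Notation haar := (@haar R).
Local Notation T := (@torus_map R).
Implicit Types (f g : R3 -> R) (B : set (torus R)).

Lemma eq_corr f g B : (forall p, cube p -> f p = g p) -> corr f B = corr g B.
Proof.
by move=> fg; congr fine; apply: eq_integral => p /set_mem/fg ->.
Qed.

Lemma corr01 f B : measurable_fun setT f -> measurable B -> (forall p, 0 <= f p <= 1) ->
  (\int[lambda3]_(p in cube) (f p * \1_(proj @^-1` B) p)%:E = (corr f B)%:E)%E /\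
  0 <= corr f B <= 1.
Proof.
move=> mf mB f01; have [-> h] := corr_itv mf mB (lexx 0) (fun p _ => f01 p).
by have m1 := mass_le1 mB; split=> //; rewrite mul0r mul1r in h; lra.
Qed.

Lemma corrD f g B : measurable_fun setT f -> measurable_fun setT g -> measurable B ->
  (forall p, 0 <= f p <= 1) -> (forall p, 0 <= g p <= 1) ->
  (forall p, 0 <= f p + g p <= 1) ->
  corr (fun p => f p + g p) B = corr f B + corr g B.
Proof.
move=> mf mg mB f01 g01 fg01.
have mfg : measurable_fun setT (fun p => f p + g p) by exact: measurable_funD.
have [Ef _] := corr01 mf mB f01; have [Eg _] := corr01 mg mB g01.
have [Efg _] := corr01 mfg mB fg01.
have ind0 (A : set R3) p : 0 <= \1_A p :> R by rewrite indicE.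
suff : ((corr (fun p => f p + g p) B)%:E = (corr f B)%:E + (corr g B)%:E)%E.
  by rewrite -EFinD => -[].
rewrite -Ef -Eg -Efg -ge0_integralD; last 5 first.
- exact: measurable_unit_cube.
- by move=> p _; rewrite lee_fin mulr_ge0 //; case/andP: (f01 p).
- exact: measurable_funTS (measurable_EFin_indic mf mB).
- by move=> p _; rewrite lee_fin mulr_ge0 //; case/andP: (g01 p).
- exact: measurable_funTS (measurable_EFin_indic mg mB).
by apply: eq_integral => p _; rewrite -EFinD mulrDl.
Qed.

Lemma corrB f g B : measurable_fun setT f -> measurable_fun setT g -> measurable B ->
  (forall p, 0 <= g p) -> (forall p, g p <= f p) -> (forall p, f p <= 1) ->
  corr (fun p => f p - g p) B = corr f B - corr g B.
Proof.
move=> mf mg mB g0 gf f1.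
have mfg : measurable_fun setT (fun p => f p - g p) by exact: measurable_funB.
have := @corrD _ _ B mfg mg mB.
rewrite (_ : (fun p => f p - g p + g p) = f); last by apply/funext => p; rewrite subrK.
move=> ->; rewrite ?addrK //; move=> p; have := g0 p; have := gf p; have := f1 p; lra.
Qed.

Lemma corr_le_setT f B : measurable_fun setT f -> measurable B ->
  (forall p, 0 <= f p <= 1) -> corr f B <= corr f setT.
Proof.
move=> mf mB f01; have [E _] := corr01 mf mB f01; have [E' _] := corr01 mf measurableT f01.
rewrite -lee_fin -E -E'; apply: ge0_le_integral; first exact: measurable_unit_cube.
- by move=> p _; rewrite lee_fin mulr_ge0 ?indicE //; case/andP: (f01 p).
- exact: measurable_funTS (measurable_EFin_indic mf mB).
- exact: measurable_funTS (measurable_EFin_indic mf measurableT).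
- move=> p _; rewrite lee_fin ler_wpM2l //; first by case/andP: (f01 p).
  by rewrite !indicE preimage_setT in_setT; case: (_ \in _).
Qed.

Lemma exact_funB f g : measurable_fun setT f -> measurable_fun setT g ->
  (forall p, 0 <= g p) -> (forall p, g p <= f p) -> (forall p, f p <= 1) ->
  exact_fun f -> exact_fun g -> exact_fun (fun p => f p - g p).
Proof.
move=> mf mg g0 gf f1 Ef Eg e e0; have e2 : 0 < e / 2 by rewrite divr_gt0.
have [N1 H1] := Ef _ e2; have [N2 H2] := Eg _ e2.
exists (maxn N1 N2) => n B; rewrite geq_max => /andP[n1 n2] mB.
have := H1 n B n1 mB; have := H2 n B n2 mB.
rewrite !corrB //; last exact: measurable_iter_preimage.
rewrite !ler_norml; lra.
Qed.

(** A function that is close to [f] in L^1 has nearly the same integral over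
    every set, so the uniformity in [B] is not lost. *)
Lemma exact_fun_approx f : measurable_fun setT f -> (forall p, f p <= 1) ->
  (forall e : R, 0 < e -> exists g, [/\ measurable_fun setT g, (forall p, 0 <= g p <= f p),
     exact_fun g & corr f setT - corr g setT <= e]) ->
  exact_fun f.
Proof.
move=> mf f1 H e e0; have e4 : 0 < e / 4 by rewrite divr_gt0.
have [g [mg gf Eg fg]] := H _ e4; have [N HN] := Eg _ e4.
have g0 p : 0 <= g p by case/andP: (gf p).
have gf' p : g p <= f p by case/andP: (gf p).
have mfg : measurable_fun setT (fun p => f p - g p) by exact: measurable_funB.
exists N => n B Nn mB; have := HN n B Nn mB.
have mX := measurable_iter_preimage n mB; set X := _ @^-1` B in mX *.
have fg01 p : 0 <= f p - g p <= 1 by have := g0 p; have := gf' p; have := f1 p; lra.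
have := corr_le_setT mfg mX fg01; have [_ /andP[+ _]] := corr01 mfg mX fg01.
rewrite !corrB //.
have m0 := mass_ge0 B; have m1 := mass_le1 mB.
have [_ /andP[+ _]] := corr01 mfg measurableT fg01; rewrite corrB // => c0.
have h : (corr f setT - corr g setT) * mass B <= e / 4.
  by rewrite (le_trans _ fg) // ler_piMr.
have h' : 0 <= (corr f setT - corr g setT) * mass B by rewrite mulr_ge0.
rewrite !ler_norml; lra.
Qed.

Lemma exact_fun_lim (F : nat -> R3 -> R) f : (forall k, measurable_fun setT (F k)) ->
  measurable_fun setT f -> (forall p, f p <= 1) ->
  (forall k p, 0 <= F k p <= f p) -> (forall p, nondecreasing_seq (F ^~ p)) ->
  (forall p, F k p @[k --> \oo] --> f p) -> (forall k, exact_fun (F k)) -> exact_fun f.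
Proof.
move=> mF mf f1 F01 Fnd Fcvg EF; apply: exact_fun_approx => // e e0.
have F0 k p : 0 <= F k p by case/andP: (F01 k p).
have Ff k p : F k p <= f p by case/andP: (F01 k p).
have F1 k p : 0 <= F k p <= 1 by rewrite F0 (le_trans (Ff k p)).
have f0 p : 0 <= f p <= 1 by rewrite (le_trans (F0 0%N p)) //= f1.
have ind0 (A : set R3) p : 0 <= \1_A p :> R by rewrite indicE.
suff : corr (F k) setT @[k --> \oo] --> corr f setT.
  move=> /cvgrPdist_lt /(_ e e0)[k _ /(_ k (leqnn k)) /= hk].
  exists (F k); split=> //; exact: le_trans (ler_norm _) (ltW hk).
have [Ef _] := corr01 mf measurableT f0.
have EFk k := (corr01 (mF k) measurableT (F1 k)).1.
pose G k p := (F k p * \1_(proj @^-1` setT) p)%:E.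
have limG p : limn (G ^~ p) = (f p * \1_(proj @^-1` setT) p)%:E.
  apply/cvg_lim => //; apply/cvg_EFin; first exact: nearW.
  exact: cvgM (Fcvg p) (cvg_cst _).
have C : (\int[lambda3]_(p in cube) G k p @[k --> \oo] -->
    \int[lambda3]_(p in cube) limn (G ^~ p))%E.
  apply: (@cvg_monotone_convergence _ _ R lambda3 cube (@measurable_unit_cube R) G).
  - by move=> k; exact: measurable_funTS (measurable_EFin_indic (mF k) measurableT).
  - by move=> k p _; rewrite lee_fin mulr_ge0.
  - by move=> p _ k l kl; rewrite lee_fin ler_wpM2r // Fnd.
rewrite (eq_integral (fun p => (f p * \1_(proj @^-1` setT) p)%:E)) in C; last first.
  by move=> p _; exact: limG.
rewrite Ef (_ : (fun k => _) = (fun k => (corr (F k) setT)%:E)) in C; last exact/funext.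
exact: fine_cvg C.
Qed.

End exactness_closure.

Section exact_sets.
Variable R : realType.
Local Notation mR := (measurableTypeR R).
Local Notation R3 := (mR * mR * mR)%type.
Local Notation lambda3 := (@lebesgue3 R).
Local Notation cube := (@unit_cube R).
Local Notation proj := (@torus_pi R : R3 -> torus R).
Local Notation haar := (@haar R).
Local Notation T := (@torus_map R).
Implicit Types (f g : R3 -> R) (A : set R3) (B : set (torus R)).

Definition exact_sets : set (set R3) :=
  [set A | measurable A /\ exact_fun (\1_A : R3 -> R)].

Lemma indic01 A p : 0 <= (\1_A p : R) <= 1.
Proof. by rewrite indicE; case: (_ \in _); rewrite /= ?lexx ?ler01. Qed.

Lemma exact_sets_lambda_system : lambda_system setT exact_sets.
Proof.
split.
- by move=> A _.
- split; first exact: measurableT.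
  apply: (@lipschitz_exact R 0).
  + exact: measurable_indic.
  + exact: indic01.
  + by move=> x y z a b; rewrite !indicE !in_setT.
  + exact: lexx.
  + by move=> p q; rewrite !indicE !in_setT subrr normr0 mul0r.
- move=> A A' A'A [mA EA] [mA' EA']; split; first exact: measurableD.
  have le p : \1_A' p <= \1_A p :> R.
    rewrite !indicE; have [/set_mem/A'A/mem_set ->|_] := boolP (p \in A') => //=.
  rewrite (_ : \1_(A `\` A') = fun p => \1_A p - \1_A' p); last first.
    apply/funext => p; rewrite !indicE in_setD.
    have [/set_mem/A'A/mem_set ->|_] := boolP (p \in A'); first by rewrite subrr.
    by rewrite andbT subr0.
  by apply: exact_funB => //; exact: measurable_indic.
- move=> F ndF EF; have mU : measurable (\bigcup_i F i).
    by apply: bigcupT_measurable => i; case: (EF i).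
  split=> //.
  apply: (@exact_fun_lim R (fun k => \1_(F k))).
  + by move=> k; apply: measurable_indic; case: (EF k).
  + exact: measurable_indic.
  + by move=> p; case/andP: (indic01 (\bigcup_i F i) p).
  + move=> k p; have /andP[-> _] := indic01 (F k) p; rewrite !indicE /=.
    have [/set_mem pF|_] := boolP (p \in F k); last by [].
    by rewrite mem_set //; exists k.
  + move=> p k l /ndF/subsetPset Fkl; rewrite !indicE.
    by have [/set_mem/Fkl/mem_set ->|_] := boolP (p \in F k).
  + move=> p; rewrite indicE; have [/set_mem[i _ pF]|pF] := boolP (p \in _).
      apply: cvg_near_cst; exists i => // k /= ik.
      by rewrite indicE mem_set //; move/subsetPset: (ndF _ _ ik); apply.
    apply: cvg_near_cst; apply: nearW => k; rewrite indicE memNset //.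
    by move=> pFk; move/negP: pF; apply; apply/mem_set; exists k.
  + by move=> k; case: (EF k).
Qed.

(** A pi-system that generates the Borel sets and whose members can be
    approximated from below by Lipschitz functions.  Only the trace on the unit
    cube is prescribed, so that periodicity does not exclude half-spaces. *)
Definition lipschitz_open : set (set R3) := [set A | measurable A /\
  exists (K : R) (psi : R3 -> R), [/\ 0 <= K, measurable_fun setT psi,
    (forall p, 0 <= psi p), yz_periodic psi & skew_lipschitz K psi /\
    forall p, cube p -> A p <-> 0 < psi p]].

Lemma dist_min_le (a b c d : R) : `|Num.min a b - Num.min c d| <= `|a - c| + `|b - d|.
Proof.
have h1 := ler_norm (a - c); have h2 := ler_norm (b - d).
have := ler_norm (- (a - c)); have := ler_norm (- (b - d)); rewrite !normrN => h3 h4.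
have := normr_ge0 (a - c); have := normr_ge0 (b - d).
rewrite ler_norml; have [ab|ab] := leP a b; have [cd|cd] := leP c d; lra.
Qed.

Lemma lipschitz_open_setI : setI_closed lipschitz_open.
Proof.
move=> A A' [mA [K [psi [K0 mpsi psi0 per [lip H]]]]]
  [mA' [K' [psi' [K0' mpsi' psi0' per' [lip' H']]]]].
split; first exact: measurableI.
exists (K + K'), (fun p => Num.min (psi p) (psi' p)); split.
- exact: addr_ge0.
- exact: measurable_minr.
- by move=> p; rewrite le_min psi0 psi0'.
- by move=> x y z a b; rewrite per per'.
- split; first by move=> p q; rewrite (le_trans (dist_min_le _ _ _ _)) // mulrDl lerD.
  move=> p cp; rewrite lt_min; split.
    by case=> /(H p cp) -> /(H' p cp) ->.
  by case/andP => /(H p cp) a /(H' p cp).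
Qed.

(** The indicator is the increasing limit of the Lipschitz functions min (1, k psi). *)
Lemma lipschitz_open_exact : lipschitz_open `<=` exact_sets.
Proof.
move=> A [mA [K [psi [K0 mpsi psi0 per [lip H]]]]]; split=> //.
pose P := [set p | 0 < psi p].
have mP : measurable P by exact: measurable_superlevel.
have EP : exact_fun (\1_P : R3 -> R).
  apply: (@exact_fun_lim R (fun k p => Num.min 1 (k%:R * psi p))).
  - by move=> k; apply: measurable_minr => //; exact: measurable_funM.
  - exact: measurable_indic.
  - by move=> p; case/andP: (indic01 P p).
  - move=> k p; rewrite le_min ler01 mulr_ge0 //= indicE.
    have [_|/negP pP] := boolP (p \in P); first by rewrite ge_min lexx.
    have -> : psi p = 0.
      apply/eqP; rewrite eq_le psi0 andbT leNgt; apply/negP => h; apply: pP.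
      exact/mem_set.
    by rewrite mulr0 ge_min lexx orbT.
  - move=> p k l kl; rewrite le_min ge_min lexx /= ge_min; apply/orP; right.
    by rewrite ler_wpM2r // ler_nat.
  - move=> p; rewrite indicE; have [/set_mem pP|/negP pP] := boolP (p \in P).
      apply: cvg_near_cst; exists (Num.bound (psi p)^-1) => // k /= kb.
      have i0 : 0 <= (psi p)^-1 by rewrite invr_ge0.
      apply: min_l; rewrite -ler_pdivrMr // mul1r.
      by rewrite (le_trans (ltW (archi_boundP i0))) // ler_nat.
    have -> : psi p = 0.
      apply/eqP; rewrite eq_le psi0 andbT leNgt; apply/negP => h; apply: pP.
      exact/mem_set.
    by apply: cvg_near_cst; apply: nearW => k; rewrite mulr0 min_r.
  - move=> k; apply: (@lipschitz_exact R (k%:R * K)).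
    + by apply: measurable_minr => //; exact: measurable_funM.
    + by move=> p; rewrite le_min ler01 mulr_ge0 //= ge_min lexx.
    + by move=> x y z a b; rewrite per.
    + exact: mulr_ge0.
    + move=> p q; rewrite (le_trans (dist_min_le _ _ _ _)) // subrr normr0 add0r.
      by rewrite -mulrBr normrM normr_nat -mulrA ler_wpM2l.
move=> e e0; have [N HN] := EP e e0; exists N => n B Nn mB.
have EAP p : cube p -> \1_A p = \1_P p :> R.
  move=> cp; rewrite !indicE; congr (_ %:R); congr nat_of_bool.
  by apply/idP/idP => /set_mem h; apply/mem_set; exact/(H p cp).
by rewrite !(eq_corr _ EAP) HN.
Qed.

End exact_sets.

(** * Lipschitz functions that detect half-spaces *)

Section mixing.
Variable R : realType.
Local Notation mR := (measurableTypeR R).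
Local Notation R3 := (mR * mR * mR)%type.
Local Notation cube := (@unit_cube R).
Local Notation proj := (@torus_pi R : R3 -> torus R).
Local Notation haar := (@haar R).
Local Notation T := (@torus_map R).

Lemma dist_max0_le (a b : R) : `|Num.max 0 a - Num.max 0 b| <= `|a - b|.
Proof.
have := ler_norm (a - b); have := ler_norm (- (a - b)); rewrite normrN => h1 h2.
have := normr_ge0 (a - b).
rewrite ler_norml; have [x|x] := leP 0 a; have [y|y] := leP 0 b; lra.
Qed.

Lemma phi_abs (x : R) : phi `|x| = phi x.
Proof.
rewrite /phi -(cos_norm (x * _)) normrM (@ger0_norm _ (pi *+ 2)) //.
by rewrite mulrn_wge0 // pi_ge0.
Qed.

Lemma phi_lt (x y : R) : 0 <= x <= 1 / 2 -> 0 <= y <= 1 / 2 -> (phi x < phi y) = (y < x).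
Proof.
have p0 := pi_gt0 R.
have h t : 0 <= t <= 1 / 2 -> t * (pi *+ 2) \in `[0, pi : R].
  move=> /andP[t0 t1]; have -> : t * (pi *+ 2) = (t * 2) * pi by ring.
  by rewrite in_itv /= mulr_ge0 ?(ltW p0) ?ler_piMl ?(ltW p0) //; lra.
move=> x01 y01; rewrite /phi ltr_cos ?h // ltr_pM2r // mulrn_wgt0 //.
Qed.

(** The points of [0, 1) beyond [c] form an arc centred at (c + 1) / 2, that is,
    a set on which the cosine centred there exceeds its value at the ends. *)
Lemma phi_arc (c y : R) : 0 <= c < 1 -> 0 <= y < 1 ->
  c < y <-> phi ((1 - c) / 2) < phi (y - (c + 1) / 2).
Proof.
move=> c01 y01; rewrite -(phi_abs (y - _)); set t := `|_|.
have t0 : 0 <= t by exact: normr_ge0.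
have hr : 0 <= (1 - c) / 2 <= 1 / 2 by lra.
split=> [cy|].
  have ht : t < (1 - c) / 2 by rewrite /t ltr_norml; lra.
  by rewrite phi_lt //; lra.
apply: contraTT; rewrite -!leNgt => yc.
have tE : t = (c + 1) / 2 - y by rewrite /t ler0_norm; lra.
have [t1|t1] := leP t (1 / 2).
  by rewrite leNgt phi_lt // -?leNgt; lra.
rewrite -phi_abs -(phi_periodic (-1)) -phi_abs leNgt phi_lt -?leNgt //;
  rewrite (ger0_norm t0) ler0_norm; lra.
Qed.

(** The periodicity makes the half-line visible from the torus; only its trace
    on the fundamental interval matters. *)
Definition circle_detector (c : R) (psi : R -> R) :=
  [/\ measurable_fun (setT : set mR) psi, (forall y, 0 <= psi y),
      (forall y (m : int), psi (y + m%:~R) = psi y),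
      (forall y y', `|psi y - psi y'| <= phi_lip R * `|y - y'|) &
      forall y, 0 <= y < 1 -> c < y <-> 0 < psi y].

Lemma circle_detector_exists (c : R) : exists psi, circle_detector c psi.
Proof.
have cst_case (k : R) : 0 <= k -> (forall y, 0 <= y < 1 -> c < y <-> 0 < k) ->
    exists psi, circle_detector c psi.
  move=> k0 H; exists (cst k); split => // y y'.
  by rewrite subrr normr0 mulr_ge0 // ltW // phi_lip_gt0.
have [c0|c0] := ltP c 0.
  by apply: (cst_case 1) => // y y01; split=> _ //; lra.
have [c1|c1] := ltP c 1; last first.
  by apply: (cst_case 0) => // y y01; rewrite ltxx; split=> //; lra.
exists (fun y => Num.max 0 (phi (y - (c + 1) / 2) - phi ((1 - c) / 2))); split.
- apply: measurable_maxr => //; apply: measurable_funB => //.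
  apply: measurableT_comp; first exact: measurable_phi.
  exact: measurable_funB.
- by move=> y; rewrite le_max lexx.
- by move=> y m; rewrite addrAC phi_periodic.
- move=> y y'; rewrite (le_trans (dist_max0_le _ _)) //.
  rewrite opprB addrA subrK (le_trans (phi_lipschitz _ _)) //.
  by rewrite opprB addrA subrK.
- move=> y y01; rewrite lt_max ltxx /= subr_gt0; apply: phi_arc => //.
  by rewrite c0 c1.
Qed.

Lemma halfspace_x (a : R) : lipschitz_open [set p : R3 | a < p.1.1].
Proof.
have C0 := phi_lip_gt0 R.
split; first by apply: measurable_superlevel; exact: measurable_coord1.
exists (2 * phi_lip R)^-1, (fun p => Num.max 0 (p.1.1 - a)); split => //.
- by rewrite invr_ge0 mulr_ge0 // ltW.
- apply: measurable_maxr => //; apply: measurable_funB => //.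
  exact: measurable_coord1.
- by move=> p; rewrite le_max lexx.
split; last by move=> p _; rewrite lt_max ltxx /= subr_gt0.
move=> p q; rewrite (le_trans (dist_max0_le _ _)) //.
rewrite opprB addrA subrK mulrC ler_pdivlMr ?mulr_gt0 // /skew_dist mulrC -addrA.
by rewrite lerDl addr_ge0.
Qed.

Lemma halfspace_y (a : R) : lipschitz_open [set p : R3 | a < p.1.2].
Proof.
have C0 := phi_lip_gt0 R.
split; first by apply: measurable_superlevel; exact: measurable_coord2.
have [psi [mpsi psi0 per lip H]] := circle_detector_exists a.
exists (phi_lip R), (fun p => psi p.1.2); split => //.
- exact: ltW.
- exact: measurableT_comp mpsi (@measurable_coord2 R).
- by move=> x y z b c /=.
split.
  move=> p q; rewrite (le_trans (lip _ _)) // ler_wpM2l ?(ltW C0) // /skew_dist.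
  by rewrite addrAC lerDr addr_ge0 // mulr_ge0 // mulr_ge0 // (ltW C0).
by move=> p [[_ /=]]; rewrite in_itv /= => /H.
Qed.

Lemma halfspace_z (a : R) : lipschitz_open [set p : R3 | a < p.2].
Proof.
have C0 := phi_lip_gt0 R.
split; first by apply: measurable_superlevel; exact: measurable_snd.
have [psi [mpsi psi0 per lip H]] := circle_detector_exists a.
exists (phi_lip R), (fun p => psi p.2); split => //.
- exact: ltW.
- exact: measurableT_comp mpsi measurable_snd.
- by move=> x y z b c /=.
split.
  move=> p q; rewrite (le_trans (lip _ _)) // ler_wpM2l ?(ltW C0) // /skew_dist.
  by rewrite lerDr addr_ge0 // mulr_ge0 // mulr_ge0 // (ltW C0).
by move=> p [_ /=]; rewrite in_itv /= => /H.
Qed.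

(** The identity is measurable from the generated sigma-algebra, because its
    coordinates are measurable on the half-spaces. *)
Lemma measurable_g_lipschitz_open (A : set R3) : measurable A -> <<s @lipschitz_open R >> A.
Proof.
move=> mA; pose G := g_sigma_algebraType (@lipschitz_open R).
have comp (h : G -> mR) : (forall a, lipschitz_open [set p : R3 | a < h p]) ->
    measurable_fun setT h.
  move=> Hh; apply: (measurability _ (RGenOInfty.measurableE R)) => //.
  move=> _ [_ [a ->] <-]; rewrite setTI; apply: sub_sigma_algebra.
  rewrite (_ : _ @^-1` _ = [set p : R3 | a < h p]); first exact: Hh.
  by apply/seteqP; split => p; rewrite /= in_itv /= andbT.
have mid : measurable_fun setT (fun p : G => (p.1.1, p.1.2, p.2) : R3).
  apply: measurable_fun_pair; first apply: measurable_fun_pair.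
  - exact: (comp (fun p => p.1.1) halfspace_x).
  - exact: (comp (fun p => p.1.2) halfspace_y).
  - exact: (comp (fun p => p.2) halfspace_z).
have := mid measurableT A mA; rewrite setTI.
by rewrite (_ : _ @^-1` A = A) //; apply/seteqP; split => -[[x y] z].
Qed.

Lemma measurable_exact (A : set R3) : measurable A -> exact_fun (\1_A : R3 -> R).
Proof.
move=> /measurable_g_lipschitz_open; move: A.
suff H : <<s @lipschitz_open R >> `<=` @exact_sets R by move=> A /H[].
apply: (@lambda_system_subset _ _ (@lipschitz_open_setI R) setT) => //.
- exact: exact_sets_lambda_system.
- exact: lipschitz_open_exact.
Qed.

(** * Mixing of all orders *)

Lemma uniform_mixing (A : set (torus R)) (e : R) : measurable A -> 0 < e ->
  exists N, forall n B, (N <= n)%N -> measurable B ->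
  `|mass (A `&` iter n T @^-1` B) - mass A * mass B| <= e.
Proof.
move=> mA e0; have [N HN] := measurable_exact (mA : measurable (proj @^-1` A)) e0.
have E B : measurable B -> corr (\1_(proj @^-1` A)) B = mass (A `&` B).
  move=> mB; rewrite /corr /mass -integral_cube_indic; last exact: measurableI.
  congr fine; apply: eq_integral => p _; congr EFin.
  by rewrite preimage_setI !indicE in_setI -natrM mulnb.
exists N => n B Nn mB; have := HN n B Nn mB.
rewrite !E ?setIT //; exact: measurable_iter_preimage.
Qed.

Lemma measurable_correlation q (t : 'I_q.+1 -> nat) (A : 'I_q.+1 -> set (torus R)) :
  (forall j, measurable (A j)) ->
  measurable (\bigcap_(j in [set: 'I_q.+1]) iter (t j) T @^-1` A j).
Proof.
move=> mA; apply: fin_bigcap_measurable => //.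
by move=> j _; exact: measurable_iter_preimage.
Qed.

(** All the sets but the first are gathered into one set, which depends on n;
    the uniformity of [uniform_mixing] makes this harmless. *)
Lemma multiple_mixing q (u : 'I_q -> nat -> nat) (A : 'I_q.+1 -> set (torus R)) :
  (forall i, u i n @[n --> \oo] --> \oo) -> (forall j, measurable (A j)) ->
  mass (\bigcap_(j in [set: 'I_q.+1]) iter (\sum_(i < q | (i < j)%N) u i n) T @^-1` A j)
    @[n --> \oo] --> \prod_(j < q.+1) mass (A j).
Proof.
elim: q u A => [|q IH] u A uoo mA.
  rewrite big_ord1; apply: cvg_near_cst; apply: nearW => n; congr mass.
  apply/seteqP; split => [x /(_ ord0 I)|x Ax j _]; rewrite /= big_ord0 //.
  by rewrite (ord1 j).
pose X n := \bigcap_(j in [set: 'I_q.+1])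
  iter (\sum_(i < q | (i < j)%N) u (lift ord0 i) n) T @^-1` A (lift ord0 j).
have mX n : measurable (X n) by exact: measurable_correlation.
have E n : \bigcap_(j in [set: 'I_q.+2]) iter (\sum_(i < q.+1 | (i < j)%N) u i n) T @^-1` A j
    = A ord0 `&` iter (u ord0 n) T @^-1` X n.
  have sumS (j : 'I_q.+1) : (\sum_(i < q.+1 | (i < lift ord0 j)%N) u i n =
      \sum_(i < q | (i < j)%N) u (lift ord0 i) n + u ord0 n)%N.
    by rewrite big_mkcond big_ord_recl /= addnC [in RHS]big_mkcond.
  apply/seteqP; split => [x H|x [x0 H] j _].
    split; first by have := H ord0 I; rewrite /= big_pred0.
    by move=> j _; have := H (lift ord0 j) I; rewrite /= sumS iterD.
  have [j' ->|->] := unliftP ord0 j; last by rewrite /= big_pred0.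
  by rewrite /= sumS iterD; exact: H.
have XA : mass (X n) @[n --> \oo] --> \prod_(i < q.+1) mass (A (lift ord0 i)).
  by apply: IH => [i|j]; [exact: uoo|exact: mA].
rewrite big_ord_recl.
under eq_fun do rewrite E.
have lim2 : mass (A ord0) * mass (X n) @[n --> \oo] -->
    mass (A ord0) * \prod_(i < q.+1) mass (A (lift ord0 i)).
  exact: cvgM (cvg_cst _) XA.
rewrite -[mass (A ord0) * \prod_(i < _) _]add0r.
rewrite (_ : (fun n => mass (A ord0 `&` _)) = fun n =>
  (mass (A ord0 `&` iter (u ord0 n) T @^-1` X n) - mass (A ord0) * mass (X n)) +
  mass (A ord0) * mass (X n)); last by apply/funext => n; rewrite subrK.
apply: cvgD lim2; apply/cvgrPdist_le => e e0.
have [N HN] := uniform_mixing (mA ord0) e0.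
have /cvgnyPge /(_ N) := uoo ord0; apply: filterS => n Nn.
by rewrite sub0r normrN HN.
Qed.

Lemma torus_map_mixing : mixing_of_all_orders haar T.
Proof.
move=> [|[|q]] // _ u uoo A mA.
have mB n := measurable_correlation (fun j : 'I_q.+2 => \sum_(i < q.+1 | (i < j)%N) u i n)%N mA.
rewrite (eq_bigr (fun j => (mass (A j))%:E)); last by move=> j _; exact: haar_fineE.
have -> : (\prod_(j < q.+2) (mass (A j))%:E = (\prod_(j < q.+2) mass (A j))%:E)%E.
  by rewrite prodEFin.
under eq_fun do rewrite (haar_fineE (mB _)).
apply: cvg_EFin; first exact: nearW.
exact: multiple_mixing.
Qed.

End mixing.

(** * Failure of the monotone shrinking target property *)

Section shrinking_targets.
Variable R : realType.
Local Notation mR := (measurableTypeR R).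
Local Notation R3 := (mR * mR * mR)%type.
Local Notation lambda3 := (@lebesgue3 R).
Local Notation cube := (@unit_cube R).
Local Notation proj := (@torus_pi R : R3 -> torus R).
Local Notation haar := (@haar R).
Local Notation T := (@torus_map R).
Local Notation mu := (@lebesgue_measure R).
Local Notation origin := (torus_pi (0 : R * R * R)).

Lemma ball_originP (r : R) (p : R * R * R) : ball origin r (torus_pi p) <->
  exists a b c : int, [/\ `|p.1.1 - a%:~R| < r, `|p.1.2 - b%:~R| < r & `|p.2 - c%:~R| < r].
Proof.
rewrite ballEmdist /=; split.
  move=> /(inf_lt (torus_dist_set_inf _ _).1)[_ [x x0 [y yp <-]] xyr].
  move: x0 yp => /torus_pi_eq /and3P[/intrP[a Ea] /intrP[b Eb] /intrP[c Ec]].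
  move=> /torus_pi_eq /and3P[/intrP[a' Ea'] /intrP[b' Eb'] /intrP[c' Ec']].
  have [e1 [e2 e3]] : p.1.1 - (a - a')%:~R = y.1.1 - x.1.1 /\
      p.1.2 - (b - b')%:~R = y.1.2 - x.1.2 /\ p.2 - (c - c')%:~R = y.2 - x.2.
    by rewrite !intrB -Ea -Ea' -Eb -Eb' -Ec -Ec' /=; split; [|split]; ring.
  move: xyr; rewrite !prod_normE /= !gt_max -andbA => /and3P[h1 h2 h3].
  by exists (a - a'), (b - b'), (c - c');
    rewrite e1 e2 e3 !(distrC y.1.1, distrC y.1.2, distrC y.2).
move=> [a [b [c [h1 h2 h3]]]].
have <- : torus_pi (a%:~R, b%:~R, c%:~R) = origin.
  by rewrite -(torus_pi_shift 0 a b c) /= !add0r.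
apply: (le_lt_trans (torus_dist_le _ _)).
by rewrite !prod_normE /= !gt_max !(distrC a%:~R, distrC b%:~R, distrC c%:~R) h1 h2 h3.
Qed.

Lemma measurable_ball_origin (r : R) : measurable (ball origin r : set (torus R)).
Proof.
suff : measurable (proj @^-1` ball origin r : set R3) by [].
have mbox (c : R) : measurable ([set x | `|x - c| < r] : set mR).
  rewrite (_ : [set _ | _] = `]c - r, c + r[%classic); first exact: measurable_itv.
  by apply/seteqP; split => x /=; rewrite in_itv /= ltr_norml; lra.
rewrite (_ : _ @^-1` _ = \bigcup_(v : int * int * int)
  ([set x : mR | `|x - v.1.1%:~R| < r] `*` [set x : mR | `|x - v.1.2%:~R| < r] `*`
   [set x : mR | `|x - v.2%:~R| < r])).
  apply: countable_bigcupT_measurable => // v.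
  by apply: measurableX => //; exact: measurableX.
apply/seteqP; split => p.
  by move=> /ball_originP [a [b [c [h1 h2 h3]]]]; exists (a, b, c).
by move=> [[[a b] c] _ [[/= h1 h2] h3]]; apply/ball_originP; exists a, b, c.
Qed.

Lemma haar_ball_ge (r : R) : 0 < r <= 1 -> ((r ^+ 3)%:E <= haar (ball origin r))%E.
Proof.
move=> /andP[r0 r1]; pose I := (`[0, r[%classic : set mR).
have mI : measurable I by exact: measurable_itv.
have lI : mu I = r%:E by rewrite lebesgue_measure_itv /= lte_fin r0 oppr0 adde0.
have -> : ((r ^+ 3)%:E = lambda3 (I `*` I `*` I))%E.
  rewrite /lebesgue3 product_measure1E //; last exact: measurableX.
  rewrite [X in (X * _)%E]product_measure1E //.
  by rewrite [X in (_ = (X * X) * X)%E]lI -!EFinM !exprS expr0 mulr1 mulrA.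
apply: le_measure; rewrite ?inE.
- by apply: measurableX => //; exact: measurableX.
- apply: measurableI; first exact: measurable_ball_origin.
  exact: measurable_unit_cube.
move=> p [[]]; rewrite /I /= !in_itv /= => h1 h2 h3; split; last first.
  by split; [split|]; rewrite /= in_itv /=; lra.
apply/ball_originP; exists 0, 0, 0; split; rewrite subr0 ger0_norm; lra.
Qed.

(** The displacement is a Birkhoff sum of [phi], and [phi] is bounded by 1. *)
Lemma iter_skew_map n (p : R * R * R) : exists2 S, `|S| <= n%:R &
  (iter n (@skew_map R) p).1.2 = p.1.2 + S /\
  (iter n (@skew_map R) p).2 = p.2 + liouville R * S.
Proof.
elim: n => [|n [S Sn [Ey Ez]]].
  by exists 0; rewrite ?normr0 // mulr0 !addr0.
exists (S + phi (iter n (@skew_map R) p).1.1).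
  by rewrite -natr1 (le_trans (ler_normD _ _)) // lerD // norm_phi_le1.
by rewrite /= Ey Ez mulrDr !addrA.
Qed.

Lemma expo_gap k : (2 + 7 * expo k + 2 * expo k <= expo k.+1)%N.
Proof. by rewrite expoS; have := expo_ge k; lia. Qed.

Definition radius k : R := (2 ^+ (2 * expo k))^-1.
Definition horizon k := (2 ^ (7 * expo k))%N.

(** A neighbourhood of a segment of direction (1, [liouville]) in the fibre. *)
Definition flow_strip (s d : R) : set R3 := [set p | `|p.2 - liouville R * p.1.2 - s| < d].

Definition resonance_strip k (i : nat) : set R3 :=
  flow_strip ((i%:R - 2 * 2 ^+ expo k) / 2 ^+ expo k) (3 * radius k) `&` cube.

(** The strips of slope [liouville] around the points (0, m / q) with |m| <= 2 q,
    where q = 2 ^ expo k; the index [i] stands for m + 2 q. *)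
Definition resonance k : set R3 :=
  \big[setU/set0]_(i < 4 * 2 ^ expo k + 1) resonance_strip k i.

Lemma radius_gt0 k : 0 < radius k.
Proof. by rewrite /radius invr_gt0 exprn_gt0. Qed.

Lemma radius_small k : 3 * radius k <= 1.
Proof.
rewrite -ler_pdivlMl // mulr1 lef_pV2 ?posrE ?exprn_gt0 //.
apply: (@le_trans _ _ (2 ^+ 2)); first by rewrite -natrX ler_nat.
by rewrite ler_eXn2l ?ltr1n//; have := expo_ge k; lia.
Qed.

Lemma shift_index (m : int) (Q : nat) : - (2 * Q%:Z) <= m <= 2 * Q%:Z ->
  exists2 i : nat, (i < 4 * Q + 1)%N & i%:Z = m + 2 * Q%:Z.
Proof. by move=> h; exists (absz (m + 2 * Q%:Z)); lia. Qed.

(** If the displacement [S] brings (y, z) within [rho] of an integer point (b, c),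
    then eliminating [S] shows that z - alpha y is within 2 [rho] of c - alpha b.
    Here |b| = O(n), so that alpha may be replaced by p / q at the cost of
    [rho], and c - b p / q is a multiple of 1 / q. *)
Lemma hits_resonance k n (p : R3) : (n < horizon k)%N -> cube p ->
  ball origin (radius k) (iter n T (proj p)) -> resonance k p.
Proof.
move=> nN cp; rewrite iter_torus_mapE => /ball_originP[_ [b [c [_]]]].
have [S Sn [-> ->]] := iter_skew_map n p.
set y := p.1.2; set z := p.2; set al := liouville R; set rho := radius k => hb hc.
have [[_ /=] ] := cp; rewrite !in_itv /= -/y -/z => y01 z01.
have al01 := liouville01 R; rewrite -/al in al01.
have [pk _ Epk] := liouville_sum_frac R k; have := liouville_approx R k.
rewrite Epk -/al => /andP[a1 a2].
set q : R := 2 ^+ expo k in Epk a1 a2 *.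
have q0 : 0 < q by rewrite exprn_gt0.
have rho0 : 0 < rho := radius_gt0 k.
have rho1 : 3 * rho <= 1 := radius_small k.
have bn : `|b%:~R| <= n%:R + 2 :> R.
  move: hb Sn; rewrite !ltr_norml !ler_norml; lra.
have err : `|b%:~R * (al - pk%:R / q)| <= rho.
  have nN' : n%:R + 2 <= 2 ^+ (7 * expo k) + 1 :> R.
    have : n.+1%:R <= (horizon k)%:R :> R by rewrite ler_nat.
    by rewrite /horizon natrX -natr1; lra.
  have N1 : (1 : R) <= 2 ^+ (7 * expo k) by rewrite exprn_ege1 // ler1n.
  have d0 : 0 <= al - pk%:R / q by lra.
  rewrite normrM (ger0_norm d0).
  apply: (@le_trans _ _ (2 * 2 ^+ (7 * expo k) * (2 / 2 ^+ expo k.+1))).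
    apply: ler_pM => //; lra.
  rewrite /rho /radius -[leRHS]mul1r ler_pdivlMr ?exprn_gt0 //.
  have -> : 2 * 2 ^+ (7 * expo k) * (2 / 2 ^+ expo k.+1) * 2 ^+ (2 * expo k)
     = 2 ^+ (2 + 7 * expo k + 2 * expo k) / 2 ^+ expo k.+1 :> R.
    rewrite !exprD expr2; field; rewrite expf_neq0 //.
  rewrite ler_pdivrMr ?exprn_gt0 // mul1r ler_eXn2l ?ltr1n //.
  exact: expo_gap.
(* The multiple m / q = c - b p / q of 1 / q is the one near z - alpha y. *)
pose m : int := c * (2 ^ expo k)%N%:Z - b * pk%:Z.
have qE : (2 ^ expo k)%:R = q :> R by rewrite natrX.
have mE : m%:~R = c%:~R * q - b%:~R * pk%:R :> R.
  by rewrite /m intrB !intrM -!pmulrn qE.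
have w3 : `|z - al * y - m%:~R / q| < 3 * rho.
  have -> : z - al * y - m%:~R / q =
      (z + al * S - c%:~R) - al * (y + S - b%:~R) - b%:~R * (al - pk%:R / q).
    by rewrite mE; field; rewrite gt_eqF.
  have h : `|al * (y + S - b%:~R)| < rho.
    by rewrite normrM (ger0_norm _) ?(le_lt_trans _ hb) ?ler_piMl //; lra.
  move: hc h err; rewrite !ltr_norml !ler_norml; lra.
have aly : 0 <= al * y <= 1.
  have /andP[al0 al1] := al01; have /andP[y0 y1] := y01.
  by rewrite mulr_ge0 //= mulr_ile1 // ltW.
have mq : `|m%:~R| <= 2 * q :> R.
  rewrite -ler_pdivrMr // -[q in X in X <= _]gtr0_norm // -normfV -normrM.
  move: w3; rewrite ltr_norml ler_norml; lra.
have [i iq iE] : exists2 i : nat, (i < 4 * 2 ^ expo k + 1)%N & i%:Z = m + 2 * (2 ^ expo k)%N%:Z.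
  apply: shift_index.
  have e2 : (2 * (2 ^ expo k)%N%:Z)%:~R = 2 * q :> R by rewrite intrM -pmulrn qE.
  by rewrite -!(ler_int R) rmorphN /= e2 -ler_norml.
rewrite /resonance -(bigcup_mkord _ (resonance_strip k)); exists i => //.
split=> //; rewrite /flow_strip /= -/q -/rho -/y -/z -/al.
rewrite (_ : (i%:R - _) / q = m%:~R / q) //; congr (_ / q).
by rewrite (pmulrn _ i) iE intrD intrM -pmulrn qE addrK.
Qed.


Lemma measurable_flow_strip s d : measurable (flow_strip s d).
Proof.
have mg : measurable_fun setT (fun p : R3 => p.2 - liouville R * p.1.2 - s).
  apply: measurable_funB => //; apply: measurable_funB; first exact: measurable_snd.
  by apply: measurable_funM => //; exact: measurable_coord2.
rewrite (_ : flow_strip s d = setT `&`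
    (fun p : R3 => p.2 - liouville R * p.1.2 - s) @^-1` `]- d, d[).
  by apply: mg => //; exact: measurable_itv.
by apply/seteqP; split => p; rewrite /flow_strip /= in_itv /= ltr_norml; [split|case].
Qed.

(** For given x and y, the strip cuts an interval of length [2 * d] on the z axis. *)
Lemma lebesgue3_flow_strip s d : 0 <= d ->
  (lambda3 (flow_strip s d `&` cube) <= (2 * d)%:E)%E.
Proof.
move=> d0; have mS := measurable_flow_strip s d.
have mI : measurable (`[0%R, 1%R[%classic : set mR) by exact: measurable_itv.
have I1 : mu (`[0%R, 1%R[%classic : set mR) = 1%E.
  by rewrite lebesgue_measure_itv /= lte_fin ltr01 oppr0 adde0.
have int_cst : (\int[mu]_(x in `[0%R, 1%R[) (2 * d)%:E = (2 * d)%:E)%E.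
  by rewrite integral_cst // [X in (_ * X)%E]I1 mule1.
rewrite -(@integral_indic _ _ _ lambda3 cube (@measurable_unit_cube R) _ mS).
have m1 : measurable_fun setT (fun p : R3 => (\1_(flow_strip s d) p : R)%:E).
  by apply/measurable_EFinP; exact: measurable_indic.
have i0 p : (0 <= (\1_(flow_strip s d) p : R)%:E)%E by rewrite lee_fin indicE.
rewrite (ge0_integral_cube m1 i0).
have inner (x y : mR) : (\int[mu]_(z in `[0%R, 1%R[) (\1_(flow_strip s d) (x, y, z) : R)%:E <=
    (2 * d)%:E)%E.
  pose J := (`](liouville R * y + s - d), (liouville R * y + s + d)[%classic : set mR).
  have mJ : measurable J by exact: measurable_itv.
  rewrite (eq_integral (fun z => (\1_J z : R)%:E)); last first.
    move=> z _; congr EFin; rewrite !indicE; congr (_ %:R); congr nat_of_bool.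
    apply/idP/idP => /set_mem h; apply/mem_set; move: h;
      rewrite /flow_strip /J /= in_itv /= ltr_norml; lra.
  rewrite integral_indic //.
  apply: (@le_trans _ _ (mu J)).
    by apply: le_measure; rewrite ?inE //; exact: measurableI.
  rewrite lebesgue_measure_itv /= lte_fin; case: ifP => _; rewrite lee_fin; last exact: mulr_ge0.
  lra.
have Jm : measurable_fun setT (fun xy : mR * mR =>
    \int[mu]_(z in `[0%R, 1%R[) (\1_(flow_strip s d) (xy, z) : R)%:E)%E.
  exact: (measurable_integral_section mu mI m1 i0).
have J0 xy : (0 <= \int[mu]_(z in `[0%R, 1%R[) (\1_(flow_strip s d) (xy, z) : R)%:E)%E.
  exact: integral_ge0.
have middle (x : mR) : (\int[mu]_(y in `[0%R, 1%R[) \int[mu]_(z in `[0%R, 1%R[)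
    (\1_(flow_strip s d) (x, y, z) : R)%:E <= (2 * d)%:E)%E.
  rewrite -int_cst; apply: ge0_le_integral => //.
  - by apply: measurable_funTS; exact: (measurableT_comp Jm (pair1_measurable _)).
rewrite -[leRHS]int_cst; apply: ge0_le_integral => //.
- by move=> x _; exact: integral_ge0.
- apply: measurable_funTS; exact: (measurable_integral_section mu mI Jm J0).
Qed.

Lemma measurable_resonance k : measurable (resonance k).
Proof.
apply: bigsetU_measurable => i _; apply: measurableI; first exact: measurable_flow_strip.
exact: measurable_unit_cube.
Qed.

(** There are 4 q + 1 strips of measure 6 q^-2 each, and q = 2 ^ expo k is large
    enough to make the sum over k at most 1 / 2. *)
Lemma lebesgue3_resonance k : (lambda3 (resonance k) <= (2^-1 / (2 ^ k.+1)%:R)%:E)%E.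
Proof.
have mF i : measurable (resonance_strip k i).
  by apply: measurableI; [exact: measurable_flow_strip|exact: measurable_unit_cube].
have := content_subadditive lambda3 (n := (4 * 2 ^ expo k + 1)%N)
  (fun i _ => mF i) (measurable_resonance k) (@subset_refl _ _).
move=> /le_trans; apply.
have r0 := ltW (radius_gt0 k).
apply: (@le_trans _ _ (\sum_(i < 4 * 2 ^ expo k + 1) (2 * (3 * radius k))%:E)%E).
  by apply: lee_sum => i _; apply: lebesgue3_flow_strip; rewrite mulr_ge0.
rewrite sumEFin lee_fin sumr_const card_ord -[_ *+ (4 * _ + 1)]mulr_natl natrD natrM !natrX.
set q : R := 2 ^+ expo k.
have q1 : 1 <= q by rewrite exprn_ege1 // ler1n.
have rE : radius k = q^-1 * q^-1 by rewrite /radius mulnC exprM expr2 invfM.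
apply: (@le_trans _ _ (30 * q^-1)).
  rewrite rE [leLHS](_ : _ = (6 * (4 * q + 1) * q^-1) * q^-1); last by ring.
  rewrite ler_pM2r ?invr_gt0; last lra.
  by rewrite ler_pdivrMr; lra.
have -> : 2^-1 / 2 ^+ k.+1 = (2 ^+ k.+2)^-1 :> R by rewrite [in RHS]exprS invfM.
apply: (@le_trans _ _ (30 * (2 ^+ (k + 10))^-1)).
  by rewrite ler_pM2l // lef_pV2 ?posrE ?exprn_gt0 // ler_eXn2l ?ltr1n // expo_ge.
rewrite (_ : (k + 10)%N = (8 + k.+2)%N); last lia.
rewrite exprD invfM mulrA ler_piMl ?invr_ge0 ?exprn_ge0 //.
by rewrite ler_pdivrMr ?exprn_gt0 // mul1r -natrX ler_nat.
Qed.

Lemma horizon_unbounded n : exists k, (n < horizon k)%N.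
Proof.
exists n; rewrite (leq_trans (ltn_expl n (isT : (1 < 2)%N))) // leq_exp2l //.
by have := expo_ge n; lia.
Qed.

(** The approximation in use at time [n]: the first one whose horizon is beyond [n]. *)
Definition stage n := ex_minn (horizon_unbounded n).

Lemma stageP n : (n < horizon (stage n))%N.
Proof. by rewrite /stage; case: ex_minnP. Qed.

Lemma stage_le n k : (n < horizon k)%N -> (stage n <= k)%N.
Proof. by rewrite /stage; case: ex_minnP => m _ H /H. Qed.

Lemma expo_le k l : (k <= l)%N -> (expo k <= expo l)%N.
Proof. by move=> kl; rewrite leq_exp2l. Qed.

Lemma radius_le k l : (k <= l)%N -> radius l <= radius k.
Proof.
move=> kl; rewrite lef_pV2 ?posrE ?exprn_gt0 // ler_eXn2l ?ltr1n //.
by rewrite leq_mul2l expo_le.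
Qed.

(** All the targets up to the horizon q^7 have radius at least q^-2, so the partial
    sum is at least q. *)
Lemma stage_ball_sum : (\sum_(0 <= n <oo) haar (ball origin (radius (stage n))) = +oo)%E.
Proof.
apply: eq_infty => r; set k := Num.bound `|r|.
apply: (le_trans _ (nneseries_lim_ge (P := xpredT) (horizon k) (fun n _ _ => haar_ge0 _))).
have rk1 : radius k <= 1 by have := radius_small k; have := radius_gt0 k; lra.
apply: (@le_trans _ _ (\sum_(0 <= i < horizon k) (radius k ^+ 3)%:E)%E); last first.
  rewrite !big_mkord; apply: lee_sum => i _.
  have ri0 := radius_gt0 (stage i).
  have ri1 : radius (stage i) <= 1 by have := radius_small (stage i); lra.
  apply: (le_trans _ (haar_ball_ge _)); last by rewrite ri0 ri1.
  rewrite lee_fin lerXn2r ?nnegrE ?(ltW (radius_gt0 _)) // radius_le //.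
  exact/stage_le.
rewrite sumEFin lee_fin sumr_const_nat subn0 -mulr_natl /horizon natrX.
have -> : 2 ^+ (7 * expo k) * radius k ^+ 3 = 2 ^+ expo k :> R.
  rewrite /radius -exprVn -exprM exprVn (_ : 7 * expo k = expo k + 2 * expo k * 3)%N.
    by rewrite exprD mulfK // expf_neq0.
  by lia.
apply: (@le_trans _ _ (`|r|)); first exact: ler_norm.
apply: (@le_trans _ _ (k%:R)); first exact: ltW (archi_boundP (normr_ge0 r)).
by rewrite -natrX ler_nat (leq_trans
  (ltnW (ltn_expl k (isT : (1 < 2)%N)))) // leq_exp2l //; have := expo_ge k; lia.
Qed.

(** Every hit belongs to some resonance set, and all of them together have measure
    at most 1 / 2. *)
Lemma torus_map_not_MSTP : ~ MSTP haar T.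
Proof.
move=> /(_ origin (fun n => radius (stage n))) H.
have {}H := H _ stage_ball_sum; set X := \bigcap_(n in _) _ in H.
suff : (haar X <= 2^-1%:E)%E.
  rewrite H; first by rewrite lee_fin; lra.
  move=> n; rewrite (ltW (radius_gt0 _)) /= radius_le //.
  by apply: stage_le; exact: leq_trans (stageP n.+1).
have mX : measurable X.
  apply: bigcapT_measurable => n0; apply: bigcup_measurable => n _.
  by apply: measurable_iter_preimage; exact: measurable_ball_origin.
have XE : proj @^-1` X `&` cube `<=` \bigcup_k resonance k.
  move=> p [Xp cp]; have [n _ hn] := Xp 0%N I.
  by exists (stage n) => //; exact: hits_resonance (stageP n) cp hn.
have := measure_sigma_subadditive lambda3 (measurable_resonance)
  (measurableI _ _ (mX : measurable (proj @^-1` X)) (@measurable_unit_cube R)) XE.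
move=> /le_trans; apply.
apply: (@le_trans _ _ (\sum_(0 <= k <oo) (2^-1 / (2 ^ k.+1)%:R)%:E)%E).
  apply: lee_nneseries => k _ //; exact: lebesgue3_resonance.
by apply: epsilon_trick0; rewrite invr_ge0.
Qed.

End shrinking_targets.

(** * Analyticity *)

Section analyticity.
Variable R : realType.
Local Notation R3 := (R * R * R)%type.
Implicit Types (f g : R3 -> R) (x h : R3) (c : nat * nat * nat -> R).

Lemma analytic_atD f g x : analytic_at f x -> analytic_at g x ->
  analytic_at (fun y => f y + g y) x.
Proof.
move=> [c [e [e0 H]]] [c' [e' [e0' H']]].
exists (fun a => c a + c' a), (Num.min e e'); split; first by rewrite lt_min e0 e0'.
move=> h; rewrite lt_min => /andP[/H[s l] /H'[s' l']]; split.
  rewrite (_ : (fun a => _) = (fun a => (c a * monomial a h)%:E) \+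
      (fun a => (c' a * monomial a h)%:E))%E.
    exact: summableD.
  by apply/funext => a; rewrite /= mulrDl EFinD.
rewrite (_ : (fun n => _) = (fun n => power_series_psum n c h + power_series_psum n c' h)).
  exact: cvgD.
apply/funext => n; rewrite /power_series_psum -big_split; apply: eq_bigr => i _ /=.
rewrite -big_split; apply: eq_bigr => j _ /=.
by rewrite -big_split; apply: eq_bigr => k _ /=; rewrite mulrDl.
Qed.

Lemma sum_delta n (G : nat -> R) i0 : (i0 < n)%N ->
  (forall i, i != i0 -> G i = 0) -> \sum_(i < n) G i = G i0.
Proof.
move=> i0n H; rewrite (bigD1 (Ordinal i0n)) //= big1 ?addr0 // => i ii0.
by apply: H; apply: contra ii0 => /eqP E; apply/eqP/val_inj.
Qed.

Lemma analytic_at_monomial (v : R) a f x :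
  (forall h, f (x + h) = v * monomial a h) -> analytic_at f x.
Proof.
move=> H; exists (fun b => if b == a then v else 0), 1; split=> // h _; split.
  rewrite /summable (_ : esum _ _ = \esum_(b in [set a]) `|v * monomial a h|%:E)%E.
    by rewrite esum_set1 ?lte_fin ?ltry // lee_fin.
  rewrite [RHS]esum_mkcond; apply: eq_esum => b _.
  have -> : (b \in [set a]) = (b == a) by apply/idP/eqP => [/set_mem//|->]; exact/mem_set.
  case: eqP => [->|_]; rewrite ?abseEFin //.
  by rewrite mul0r abse0.
rewrite H; apply: cvg_near_cst; exists (maxn a.1.1 (maxn a.1.2 a.2)).+1 => // n /=.
rewrite !gtn_max => /and3P[n1 n2 n3].
case: a H n1 n2 n3 => -[i0 j0] k0 /= H n1 n2 n3.
pose G i j k := (if (i, j, k) == (i0, j0, k0) then v else 0) * monomial (i, j, k) h.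
rewrite /power_series_psum (@sum_delta n (fun i => \sum_(j < n) \sum_(k < n) G i j k) i0) //.
  rewrite (@sum_delta n (fun j => \sum_(k < n) G i0 j k) j0) //.
    rewrite (@sum_delta n (G i0 j0) k0) // /G ?eqxx //.
    by move=> k kk0; rewrite !xpair_eqE (negbTE kk0) !andbF mul0r.
  move=> j jj0; apply: big1 => k _.
  by rewrite /G !xpair_eqE (negbTE jj0) andbF andFb mul0r.
move=> i ii0; apply: big1 => j _; apply: big1 => k _.
by rewrite /G !xpair_eqE (negbTE ii0) !andFb mul0r.
Qed.

(** A power series in x alone is a triple series supported on an axis. *)
Lemma analytic_at_axis (t : nat -> R) f x :
  (forall h : R, cvgn (series (fun i => `|t i * h ^+ i|))) ->
  (forall h, series (fun i => t i * h.1.1 ^+ i) @ \oo --> f (x + h)) -> analytic_at f x.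
Proof.
move=> Ha H.
pose F (a : nat * nat * nat) := if (a.1.2 == 0%N) && (a.2 == 0%N) then t a.1.1 else 0.
exists F, 1; split=> // h _.
have monE i : monomial (i, 0%N, 0%N) h = h.1.1 ^+ i by rewrite /monomial /= !mulr1.
split.
  pose e i : nat * nat * nat := (i, 0%N, 0%N).
  rewrite /summable (_ : esum _ _ = \esum_(b in e @` setT) `|F b * monomial b h|%:E)%E.
    rewrite esum_image; last by move=> i j _ _ [].
    rewrite -nneseries_esumT; last by move=> n; rewrite lee_fin.
    rewrite (_ : limn _ = (limn (series (fun i => `|t i * h.1.1 ^+ i|)))%:E).
      exact: ltry.
    rewrite -EFin_lim //; congr (limn _); apply/funext => n /=.
    by rewrite /series /= sumEFin; congr EFin; apply: eq_bigr => i _; rewrite /F /= monE.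
  rewrite [RHS]esum_mkcond; apply: eq_esum => -[[i j] k] _.
  case: ifPn => // /negP nI; rewrite /F /=; case: ifPn => [/andP[/eqP j0 /eqP k0]|_].
    by exfalso; apply: nI; apply/mem_set; exists i => //; rewrite j0 k0.
  by rewrite mul0r normr0.
have : series (fun i => t i * h.1.1 ^+ i) @ \oo --> f (x + h) by exact: H.
apply: cvg_trans; apply: near_eq_cvg; exists 1%N => // n /= n0.
rewrite /power_series_psum /series /= big_mkord; apply: eq_bigr => i _.
rewrite (@sum_delta n (fun j =>
    \sum_(k < n) F (i : nat, j, k : nat) * monomial (i : nat, j, k : nat) h) 0) //.
  rewrite (@sum_delta n (fun k => F (i : nat, 0%N, k) * monomial (i : nat, 0%N, k) h) 0) //.
    by rewrite /F /= monE.
  by move=> k k0; rewrite /F /= (negbTE k0) mul0r.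
by move=> j j0; apply: big1 => k _; rewrite /F /= (negbTE j0) mul0r.
Qed.

Lemma cos_coeffM (w h : R) i : cos_coeff (w * h) i = cos_coeff w i * h ^+ i.
Proof. by rewrite /cos_coeff /= exprMn; ring. Qed.

Lemma sin_coeffM (w h : R) i : sin_coeff (w * h) i = sin_coeff w i * h ^+ i.
Proof. by rewrite /sin_coeff /= exprMn; ring. Qed.

Lemma norm_cos_coeff (w : R) i : `|cos_coeff w i| <= exp_coeff `|w| i.
Proof.
rewrite /exp_coeff /cos_coeff /= !normrM normfV !normr_nat !normrX normrN normr1 expr1n mulr1.
by case: odd; rewrite ?mul0r ?mul1r // divr_ge0.
Qed.

Lemma norm_sin_coeff (w : R) i : `|sin_coeff w i| <= exp_coeff `|w| i.
Proof.
rewrite /exp_coeff /sin_coeff /= !normrM normfV !normr_nat !normrX normrN normr1 expr1n mulr1.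
by case: odd; rewrite ?mul0r ?mul1r // divr_ge0.
Qed.

Lemma analytic_at_phi (v : R) x : analytic_at (fun y => v * phi y.1.1) x.
Proof.
pose w : R := pi *+ 2; pose A := v * cos (x.1.1 * w); pose B := v * sin (x.1.1 * w).
have tE (h : R) i : (A * cos_coeff w i - B * sin_coeff w i) * h ^+ i =
    A * cos_coeff (w * h) i - B * sin_coeff (w * h) i.
  by rewrite cos_coeffM sin_coeffM; ring.
have A1 : `|A| <= `|v| by rewrite normrM ler_piMr // cos_max.
have B1 : `|B| <= `|v| by rewrite normrM ler_piMr // sin_max.
apply: (@analytic_at_axis (fun i => A * cos_coeff w i - B * sin_coeff w i)).
  move=> h; apply: (@series_le_cvg _ _ (fun i => (`|v| + `|v|) * exp_coeff `|w * h| i)).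
  - by move=> i; exact: normr_ge0.
  - by move=> i; rewrite mulr_ge0 ?addr_ge0 // exp_coeff_ge0.
  - move=> i; rewrite tE (le_trans (ler_normB _ _)) // [leRHS]mulrDl.
    have hc := norm_cos_coeff (w * h) i; have hs := norm_sin_coeff (w * h) i.
    by rewrite lerD // normrM; apply: ler_pM.
  - exact: is_cvg_seriesZ (is_cvg_series_exp_coeff _).
move=> h; rewrite (_ : v * phi (x + h).1.1 = A * cos (w * h.1.1) - B * sin (w * h.1.1)).
  rewrite (_ : series _ = fun n => A * series (cos_coeff (w * h.1.1)) n -
      B * series (sin_coeff (w * h.1.1)) n).
    by apply: cvgB; apply: cvgM; try exact: cvg_cst; rewrite unlock;
      [exact: is_cvg_series_cos_coeff|exact: is_cvg_series_sin_coeff].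
  apply/funext => n; rewrite /series /= !mulr_sumr -sumrB.
  by apply: eq_bigr => i _; rewrite tE.
rewrite /phi /A /B /= mulrDl -/w (mulrC w) cosD; ring.
Qed.

(** The lift [skew_map] serves at every point; its components are sums of linear
    forms and of multiples of the cosine of x. *)
Lemma torus_map_analytic : torus_analytic (@torus_map R).
Proof.
move=> x; exists (@skew_map R).
have lin a (f : R3 -> R) : (forall p q : R3, f (p + q) = f p + f q) ->
    (exists v, forall h, f h = v * monomial a h) -> analytic_at f x.
  move=> fD [v fv]; have := @analytic_atD (fun=> f x) (fun y => f (y - x)) x.
  rewrite (_ : (fun y => f x + f (y - x)) = f); last first.
    by apply/funext => y; rewrite -fD addrC subrK.
  apply.
    apply: (@analytic_at_monomial (f x) (0%N, 0%N, 0%N)) => h.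
    by rewrite /monomial /= !expr0 !mulr1.
  by apply: (@analytic_at_monomial v a) => h; rewrite addrC addKr fv.
have linx := lin (1%N, 0%N, 0%N); have liny := lin (0%N, 1%N, 0%N).
have linz := lin (0%N, 0%N, 1%N).
have phi1 := analytic_at_phi 1 x.
rewrite (_ : (fun y : R3 => 1 * phi y.1.1) = (fun y => phi y.1.1)) in phi1; last first.
  by apply/funext => y; rewrite mul1r.
split.
- apply: linx; first by move=> p q /=; rewrite mulrDr.
  by exists 2 => h; rewrite /monomial /= expr1 !mulr1.
- apply: analytic_atD => //; apply: liny => //.
  by exists 1 => h; rewrite /monomial /= expr0 expr1 mulr1 !mul1r.
- apply: analytic_atD; last exact: analytic_at_phi.
  apply: linz => //.
  by exists 1 => h; rewrite /monomial /= expr1 !mul1r.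
- by near=> y; exact: torus_mapE.
Unshelve. all: by end_near. Qed.

End analyticity.

Theorem corollary3p5 (R : realType) :
  exists T : torus R -> torus R,
    [/\ torus_analytic T,
        measure_preserving (@haar R) T,
        mixing_of_all_orders (@haar R) T &
        ~ MSTP (@haar R) T].
Proof.
exists (@torus_map R); split.
- exact: torus_map_analytic.
- exact: measure_preserving_torus_map.
- exact: torus_map_mixing.
- exact: torus_map_not_MSTP.
Qed.
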